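(* There is an absolute constant $C$ such that every graph $G$ of Euler genus $\gamma$ satisfies $\vec{\chi}(G)\le C\sqrt{\gamma+1}$. More precisely, for $\gamma\ge 1$, let $D_\gamma=\left\lceil \max\{9,\,2+\sqrt{4\gamma+6}\}\right\rceil$. Then every graph $G$ of Euler genus $\gamma$ satisfies $$\vec{\chi}(G)\le \left\lceil 3+\tfrac12\sqrt{6\gamma}\right\rceil+F(D_\gamma),$$ where $F(D)=9D+6+\left\lfloor \frac32\left\lceil \frac{2D+2}{5}\right\rceil\right\rfloor$ for $D\in\mathbb{Z}_{\ge0}$.
   Context: All graphs are finite and simple. For an orientation $Q$ of $G$, $d^+_Q(v)$ is the outdegree of $v$ and $\Delta^+(Q)=\max_v d^+_Q(v)$. The orientation $Q$ is proper if $d^+_Q(u)\ne d^+_Q(v)$ for every edge $uv\in E(G)$. The proper orientation number is $\vec{\chi}(G)=\min\{\Delta^+(Q): Q\text{ is a proper orientation of }G\}$. An orientable surface of genus $g$ has Euler genus $2g$, and a nonorientable surface of genus $g$ has Euler genus $g$. The Euler genus of a graph is the minimum Euler genus of a surface in which the graph embeds. *)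

(* Defs.v *)
From HB Require Import structures.
From Stdlib Require Import Relation_Operators.
From mathcomp Require Import all_boot all_order all_algebra.

Set Implicit Arguments.
Unset Strict Implicit.
Unset Printing Implicit Defensive.
Import Order.TTheory GRing.Theory Num.Theory.
Local Open Scope ring_scope.

(* A finite simple graph is a symmetric irreflexive relation [e] on a finType. *)

Section ProperOrientation.
Context {T : finType}.
Implicit Types (e : rel T) (Q : {set T * T}) (u v w : T).

(* [(u, v) \in Q] means that the edge uv is directed from u to v. *)
Definition orientation e Q : bool :=
  [forall u, forall v,
    if e u v then ((u, v) \in Q) (+) ((v, u) \in Q) else (u, v) \notin Q].

Definition outdeg Q v : nat := #|[set w | (v, w) \in Q]|.

Definition max_outdeg Q : nat := \max_v outdeg Q v.

Definition proper_orientation e Q : bool :=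
  orientation e Q && [forall u, forall v, e u v ==> (outdeg Q u != outdeg Q v)].

(* Outdegrees are at most #|T|, so the default value #|T| does not affect the
   minimum; the minimum is over a nonempty set by
   [proper_orientation_number_attained] below. *)
Definition proper_orientation_number e : nat :=
  \big[minn/#|T|]_(Q : {set T * T} | proper_orientation e Q) max_outdeg Q.

Lemma proper_orientation_exists e :
  symmetric e -> irreflexive e -> exists Q, proper_orientation e Q.
Proof.
move=> es ei.
suff /(_ #|[set: T]| [set: T] erefl) [Q [Q1 Q2 Q3]] :
    forall n (S : {set T}), #|S| = n -> exists Q,
  [/\ forall u v, (u, v) \in Q -> [/\ u \in S, v \in S & e u v],
      forall u v, u \in S -> v \in S -> e u v ->
        ((u, v) \in Q) (+) ((v, u) \in Q) &
      forall u v, u \in S -> v \in S -> e u v -> outdeg Q u != outdeg Q v].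
  exists Q; apply/andP; split; apply/forallP => u; apply/forallP => v.
    case: ifPn => euv; first by apply: Q2; rewrite ?inE.
    by apply/negP => /Q1[_ _]; apply/negP.
  by apply/implyP => euv; apply: Q3; rewrite ?inE.
elim=> [|n IHn] S Sn.
  have -> : S = set0 by apply/eqP; rewrite -cards_eq0 Sn.
  by exists set0; split=> u v; rewrite !in_set0.
have [x0 x0S] : exists x, x \in S.
  by apply/set0Pn; rewrite -card_gt0 Sn.
pose deg v := #|[set w in S | e v w]|.
have [x xS xmax] : exists2 x, x \in S & forall v, v \in S -> (deg v <= deg x)%N.
  by case: (@arg_maxnP T x0 (mem S) deg x0S) => x xS xm; exists x.
have [|Q [Q1 Q2 Q3]] := IHn (S :\ x).
  by apply/eqP; rewrite -eqSS -Sn (cardsD1 x S) xS.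
pose Q' := (Q :|: [set p | [&& p.1 == x, p.2 \in S & e x p.2]]).
have inQ' u v : (u, v) \in Q' =
    ((u, v) \in Q) || [&& u == x, v \in S & e x v].
  by rewrite in_setU in_set.
clearbody Q'.
have Qx v : ((x, v) \in Q) = false.
  by apply/negP => /Q1[]; rewrite !inE eqxx.
have Qx' v : ((v, x) \in Q) = false.
  by apply/negP => /Q1[_]; rewrite !inE eqxx.
have outx : outdeg Q' x = deg x.
  by apply: eq_card => w; rewrite !in_set inQ' Qx eqxx.
have outu u : u != x -> outdeg Q' u = outdeg Q u.
  by move=> ux; apply: eq_card => w; rewrite !in_set inQ' (negPf ux) orbF.
have lt_out u : u \in S -> e u x -> (outdeg Q' u < deg x)%N.
  move=> uS eux; have ux : u != x by apply: contraTneq eux => ->; rewrite ei.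
  rewrite outu //; apply: leq_trans (xmax _ uS).
  rewrite /deg (cardsD1 x) in_set xS eux ltnS.
  apply: subset_leq_card; apply/fintype.subsetP => w; rewrite !in_set.
  by move=> /Q1[_]; rewrite !in_set => /andP[-> ->] ->.
exists Q'; split=> [u v|u v uS vS euv|u v uS vS euv].
- rewrite inQ' => /orP[/Q1[]|/and3P[/eqP-> -> ->]//].
  by rewrite !inE => /andP[_ ->] /andP[_ ->] ->.
- rewrite !inQ'; have [ux|ux] := eqVneq u x.
    rewrite ux in euv *; have /negPf-> : v != x.
      by apply: contraTneq euv => ->; rewrite ei.
    by rewrite Qx Qx' vS euv.
  have [vx|vx] := eqVneq v x.
    by rewrite vx in euv *; rewrite Qx Qx' uS es euv.
  by rewrite !orbF; apply: Q2 => //; rewrite !inE ?ux ?vx.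
- have [ux|ux] := eqVneq u x.
    by rewrite ux outx eq_sym ltn_eqF // lt_out // es -ux.
  have [vx|vx] := eqVneq v x.
    by rewrite vx outx ltn_eqF // lt_out // -vx.
  by rewrite !outu //; apply: Q3 => //; rewrite !inE ?ux ?vx.
Qed.

Lemma proper_orientation_number_attained e :
  symmetric e -> irreflexive e ->
  (exists2 Q, proper_orientation e Q & max_outdeg Q = proper_orientation_number e)
  /\ (forall Q, proper_orientation e Q ->
        (proper_orientation_number e <= max_outdeg Q)%N).
Proof.
move=> es ei.
have lb Q : proper_orientation e Q ->
    (proper_orientation_number e <= max_outdeg Q)%N.
  move=> pQ; rewrite /proper_orientation_number.
  by apply: (@bigmin_inf _ nat _ _ Q).
split=> //; have [Q0 pQ0] := proper_orientation_exists es ei.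
have [Q pQ Qmin] : exists2 Q, proper_orientation e Q &
    forall Q', proper_orientation e Q' -> (max_outdeg Q <= max_outdeg Q')%N.
  by case: (arg_minnP max_outdeg pQ0) => Q pQ Qm; exists Q.
exists Q => //; apply/eqP; rewrite eqn_leq lb // andbT.
rewrite /proper_orientation_number.
apply: (big_ind (fun m => max_outdeg Q <= m)%N) => //.
  by apply/bigmax_leqP => v _; apply: max_card.
by move=> m n Hm Hn; rewrite leq_min Hm.
Qed.

End ProperOrientation.

From mathcomp Require Import all_classical all_reals all_analysis.
Import numFieldNormedType.Exports.

Section Surfaces.
Local Open Scope classical_set_scope.
Context {R : realType}.

Definition disc : set (R * R) := [set p | p.1 ^+ 2 + p.2 ^+ 2 <= 1].

(* The unit circle as the boundary of an n-gon: vertices at x = 0, ..., n - 1,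
   and the i-th side is the arc i <= x <= i + 1. *)
Definition polygon_boundary (n : nat) (x : R) : R * R :=
  (cos (2 * pi * x / n%:R), sin (2 * pi * x / n%:R)).

(* A boundary word: (a, true) is the letter a, (a, false) its inverse. *)
Definition word := seq (nat * bool).

Definition glued (w : word) (p p' : R * R) : Prop :=
  exists (i j : nat) (s : R),
    let li := nth (0, true)%N w i in let lj := nth (0, true)%N w j in
    [/\ (i < size w)%N /\ (j < size w)%N,
        li.1 = lj.1,
        0 <= s <= 1,
        p = polygon_boundary (size w) (i%:R + s) &
        p' = polygon_boundary (size w)
               (j%:R + (if li.2 == lj.2 then s else 1 - s))].

(* [X] is homeomorphic to the quotient of the polygon by the gluing [w]: a
   continuous surjection from a compact space onto a Hausdorff space is a
   quotient map. *)
Definition polygon_quotient (w : word) (X : topologicalType) : Prop :=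
  hausdorff_space X /\
  exists q : R * R -> X,
    [/\ {within disc, continuous q},
        q @` disc = setT &
        forall p p', disc p -> disc p' ->
          (q p = q p' <-> clos_refl_sym_trans _ (glued w) p p')].

(* a b a^-1 b^-1 for each handle; a a^-1 for the sphere *)
Definition orientable_word (g : nat) : word :=
  if g is 0%N then [:: (0, true); (0, false)]%N else
  flatten [seq [:: (k.*2, true); (k.*2.+1, true); (k.*2, false); (k.*2.+1, false)]
          | k <- iota 0 g].

(* a a for each crosscap *)
Definition nonorientable_word (g : nat) : word :=
  flatten [seq [:: (k, true); (k, true)] | k <- iota 0 g].

(* By the classification theorem these are all the closed connected surfaces. *)
Definition orientable_surface (g : nat) (X : topologicalType) : Prop :=
  polygon_quotient (orientable_word g) X.

Definition nonorientable_surface (g : nat) (X : topologicalType) : Prop :=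
  (0 < g)%N /\ polygon_quotient (nonorientable_word g) X.

Definition surface_of_euler_genus (k : nat) (X : topologicalType) : Prop :=
  (exists2 g, k = g.*2 & orientable_surface g X) \/ nonorientable_surface k X.

(* [arc u v] is the arc drawn for the edge uv, run from u to v. *)
Definition embeds_in (T : finType) (e : rel T) (X : topologicalType) : Prop :=
  exists (pt : T -> X) (arc : T -> T -> R -> X),
    [/\ injective pt,
        forall u v, e u v ->
          [/\ {within [set` `[0, 1]], continuous (arc u v)},
              arc u v 0 = pt u & arc u v 1 = pt v],
        forall u v (t : R), e u v -> 0 <= t <= 1 -> arc v u t = arc u v (1 - t),
        forall u v w (t : R), e u v -> 0 < t < 1 -> arc u v t <> pt w &
        forall u v x y (s t : R), e u v -> e x y -> 0 < s < 1 -> 0 < t < 1 ->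
          arc u v s = arc x y t ->
          [/\ x = u, y = v & t = s] \/ [/\ x = v, y = u & t = 1 - s]].

Definition embeds_in_euler_genus (T : finType) (e : rel T) (k : nat) : Prop :=
  exists2 X : topologicalType, surface_of_euler_genus k X & embeds_in e X.

Definition has_euler_genus (T : finType) (e : rel T) (gamma : nat) : Prop :=
  embeds_in_euler_genus e gamma /\
  forall k, embeds_in_euler_genus e k -> (gamma <= k)%N.

Definition D_ (gamma : nat) : int :=
  Num.ceil (Num.max 9 (2 + Num.sqrt (4 * gamma%:R + 6)) : R).

End Surfaces.

Arguments has_euler_genus R {T} e gamma.
Arguments D_ R gamma : clear implicits.

Definition F (D : int) : int :=
  9 * D + 6 +
  Num.floor (3 / 2 * (Num.ceil ((2 * D + 2)%:~R / 5 : rat))%:~R : rat).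

(* Main.v *)
Require Import Defs.
From Stdlib Require Import Relation_Operators.
From mathcomp Require Import all_boot all_order all_algebra.
From mathcomp Require Import zify ring lra.
Set Implicit Arguments.
Unset Strict Implicit.
Unset Printing Implicit Defensive.

(** A graph drawn on a surface of Euler genus k has few edges, so all its
    subgraphs have a vertex of small degree; and a graph all of whose
    subgraphs have a vertex of degree at most d has a proper orientation of
    maximum outdegree at most 7 d + 1.  Choosing d of order sqrt k gives both
    bounds.

    Degenerate graphs ([proper_orientation_number_degenerate]).  Order the
    vertices so that each has at most d earlier neighbours, its parents; later
    neighbours are its children.  Outdegrees are handed out in decreasing
    order l = 7 d + 1, ..., 0.  At level l a set of ready vertices is fixed,
    and those in its earliest-first maximal independent subset get outdegree
    exactly l: such a vertex x points to every neighbour that does not point to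
    it already, except for pot x - l chosen children, which point to x; here
    pot x is the largest outdegree that x can still reach.  Vertices of equal
    outdegree are independent, so the orientation is proper.  The difficulty is
    that each vertex has to be served at a level not above its pot, while it
    has enough children to exclude, and that exclusion hurts the children: an
    excluded child keeps its pot while the level falls.  During the first
    d + 1 levels every vertex of pot at least 7 d + 1 is ready, and each level
    that blocks it uses up one of its d parents, so then all pots are at most
    7 d ([rich_phase]).  During the next 4 d levels a vertex is ready when it
    can exclude only children that are not ready.  If a vertex of pot above the
    level is not served, then one of its parents is processed, or many of its
    children are processed or have a parent processed.  Such events can be
    counted: in total they weigh at most 12 d ^ 2 + d around one vertex, while
    4 d levels would need 12 d ^ 2 + 6 d, so at the end all pots are at most
    the level ([kill_phase], [no_dirty_left]).  This persists in the last
    phase, in which every remaining vertex is served before its pot runs out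
    ([clean_phase]).

    Edges of graphs on surfaces ([surface_edge_bound]).  The polygon whose
    glued sides form the surface is cut by a fine polar grid.  Modulo the
    gluing this is a complex of vertices, edges and cells in which, over the
    two-element field, every cycle is a sum of cell boundaries and of the ell
    closed curves formed by the letters of the word ([polar_homology]).  The
    grid vertices of the cells that meet a connected subset of the surface
    form a connected set, and on a fine grid disjoint closed sets have
    disjoint such sets ([near_verts_conn], [near_verts_disjoint]).  Applied to
    stars around the points and to middle thirds of the arcs of a drawing,
    this exhibits the graph as a minor of the grid.  Its cycle space of
    dimension at least m - n then embeds, up to ell dimensions, into the sums
    of region boundaries, so that m <= n + ell + f for f regions bordered by
    edges.  As the border of a region is a nonzero cycle of a simple graph it
    has at least 3 edges, whence 3 f <= 2 m and m <= 3 (n + ell)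
    ([branch_sets_edge_bound], [minor_edge_bound]).  Here ell is the Euler
    genus, or 1 for the sphere.

    Consequently a subgraph of minimum degree above d has at least d + 2
    vertices, and (d + 2) (d - 5) <= 6 ell ([surface_low_degree]). *)

(** * Proper orientations of degenerate graphs *)

(** Well-founded recursion for sets.  Along the order of the vertices it gives
    greedy independent sets, along the reverse order it defines readiness. *)
Lemma rec_set (T : finType) (f : T -> nat) (Phi : T -> {set T} -> bool) :
  exists S : {set T}, forall x, (x \in S) = Phi x [set y in S | f y < f x].
Proof.
pose step (S : {set T}) := [set x | Phi x [set y in S | f y < f x]].
have stable k m x : f x < k -> k <= m ->
    (x \in iter m step set0) = (x \in iter k step set0).
  elim: k m x => // k IHk [|m] x // fx km; rewrite !iterS !inE; congr (Phi x _).
  apply/setP=> y; rewrite !inE; have [yx|] := ltnP (f y) (f x); rewrite ?andbF //.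
  by rewrite !andbT; apply: IHk => //; apply: leq_trans yx _.
pose K := (\max_x f x).+1.
exists (iter K step set0) => x.
have fK : f x < K by rewrite ltnS; apply: leq_bigmax.
by rewrite -(stable K K.+1) // iterS !inE.
Qed.

Lemma subset_of_card (T : finType) (A : {set T}) n :
  n <= #|A| -> exists2 B : {set T}, B \subset A & #|B| = n.
Proof.
move=> nA; exists [set x in take n (enum A)].
  by apply/subsetP=> x; rewrite inE => /mem_take; rewrite mem_enum.
by rewrite cardsE (card_uniqP _) ?take_uniq ?enum_uniq // size_takel // -cardE.
Qed.

Section Levels.
Context {T : finType} {e : rel T} (es : symmetric e) (ei : irreflexive e).
Context {rk : T -> nat} (rk_inj : injective rk).
Implicit Types (P I Rd : {set T}) (Q : {set T * T}) (x y v w z : T).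

Definition parents v := [set w | e v w & rk w < rk v].
Definition children P v := [set w in ~: P | e v w & rk v < rk w].
(** The largest outdegree that v can still reach: every neighbour that does not
    already point to v. *)
Definition pot Q v := #|[set w | e v w & (w, v) \notin Q]|.

(** Exactly the edges with an end in P, the set of processed vertices, are
    oriented; for processed vertices pot is the outdegree.  By the third
    condition a processed child of an unprocessed vertex always points to it,
    so pots are at most d plus the number of unprocessed children. *)
Definition partial P Q :=
  [/\ forall u v, (u, v) \in Q -> e u v /\ ((u \in P) || (v \in P)),
      forall u v, e u v -> (u \in P) || (v \in P) ->
        ((u, v) \in Q) (+) ((v, u) \in Q),
      forall u v, u \notin P -> (u, v) \in Q -> v \in parents u &
      forall u v, u \in P -> v \in P -> e u v -> pot Q u != pot Q v].

(** Scanning Rd in order and keeping what is not adjacent to a vertex kept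
    before gives a maximal independent set in which moreover each rejected
    vertex is rejected because of a parent; as there are only d parents, no
    vertex is rejected often. *)
Lemma earliest_first_mis Rd : exists I, [/\ I \subset Rd,
  forall x y, x \in I -> y \in I -> ~~ e x y &
  forall x, x \in Rd -> x \notin I -> exists2 z, z \in I & z \in parents x].
Proof.
have [I IE] := rec_set rk (fun x S => (x \in Rd) && [forall y in S, ~~ e x y]).
have lt_ind x y : x \in I -> y \in I -> rk y < rk x -> ~~ e x y.
  rewrite IE => /andP[_ /forall_inP xI] yI lt_yx.
  by apply: xI; rewrite inE yI.
exists I; split.
- by apply/subsetP => x; rewrite IE => /andP[].
- move=> x y xI yI; case: (ltngtP (rk x) (rk y)) => [xy|yx|/rk_inj->].
  + by rewrite es lt_ind.
  + exact: lt_ind.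
  + by rewrite ei.
- move=> x xR; rewrite IE xR /= => /forall_inPn[z]; rewrite inE => /andP[zI zx].
  by rewrite negbK => exz; exists z => //; rewrite inE exz.
Qed.

Lemma pot_children_le P Q v d : partial P Q -> v \notin P ->
  #|parents v| <= d -> pot Q v <= #|children P v| + d.
Proof.
move=> [Q1 Q2 Q3 _] vP vd.
apply: leq_trans (leq_add (leqnn _) vd); apply: leq_trans (leq_card_setU _ _).
apply: subset_leq_card; apply/subsetP => w; rewrite !inE => /andP[evw nQ].
rewrite evw /=; case: (ltngtP (rk w) (rk v)) => [_|vw|/rk_inj wv] /=.
- by rewrite orbT.
- rewrite andbT orbF; apply/negP => wP.
  have := Q2 v w evw; rewrite wP orbT (negPf nQ) addbF => /(_ isT) /(Q3 _ _ vP).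
  by rewrite inE evw /= ltnNge ltnW.
- by rewrite wv ei in evw.
Qed.

Lemma children_pot P Q v : partial P Q -> v \notin P ->
  #|children P v| <= pot Q v.
Proof.
move=> [Q1 Q2 Q3 _] vP; apply: subset_leq_card; apply/subsetP => w.
rewrite !inE => /and3P[wP -> _] /=; apply/negP => /Q1[_].
by rewrite (negPf wP) (negPf vP).
Qed.

(** One level: a maximal independent subset I of the ready set gets outdegree
    l.  Each x in I points to all its unprocessed neighbours except those in
    X x, which point to x and so bring its outdegree from pot x down to l.
    An unprocessed neighbour loses one unit of pot unless it is one of the
    excluded children. *)
Lemma level_step P Q l Rd (X : T -> {set T}) :
  partial P Q -> (forall v, v \in P -> l < pot Q v) -> Rd \subset ~: P ->
  (forall x, x \in Rd -> X x \subset children P x /\ #|X x| + l = pot Q x) ->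
  exists I Q', [/\ [/\ partial (P :|: I) Q', I \subset Rd,
    forall v, v \in P -> pot Q' v = pot Q v & forall v, v \in I -> pot Q' v = l],
    forall v, v \in Rd -> v \notin I -> exists2 z, z \in I & z \in parents v,
    forall v, v \notin P -> pot Q' v <= pot Q v &
    forall v z, v \notin P :|: I -> z \in I -> e v z -> v \notin X z ->
      pot Q' v < pot Q v].
Proof.
move=> pPQ Ppot RdP XP; have [Q1 Q2 Q3 Q4] := pPQ.
have [I [IR Iind Idom]] := earliest_first_mis Rd.
have IP x : x \in I -> x \notin P.
  by move/(subsetP IR)/(subsetP RdP); rewrite inE.
have XI x w : x \in I -> w \in X x -> [/\ w \notin P, w \notin I, e x w & rk x < rk w].
  move=> xI wX; have [/subsetP/(_ w wX)] := XP x (subsetP IR x xI).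
  rewrite !inE => /and3P[-> exw ->] _; split=> //; apply/negP => wI.
  by move: (Iind x w xI wI); rewrite exw.
pose Q' := Q :|: [set p | [&& p.1 \in I, p.2 \notin P, e p.1 p.2 & p.2 \notin X p.1]]
             :|: [set p | (p.2 \in I) && (p.1 \in X p.2)].
have Q'E u v : ((u, v) \in Q') = [|| (u, v) \in Q,
    [&& u \in I, v \notin P, e u v & v \notin X u] | (v \in I) && (u \in X v)].
  by rewrite !inE orbA.
clearbody Q'.
have potP v : v \in P -> pot Q' v = pot Q v.
  move=> vP; apply: eq_card => w; rewrite !inE Q'E vP /= andbF.
  have -> : v \in I = false by apply/negP => /IP; rewrite vP.
  by rewrite /= orbF.
have potle v : v \notin P -> pot Q' v <= pot Q v.
  move=> vP; apply: subset_leq_card; apply/subsetP => w.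
  by rewrite !inE Q'E => /andP[->]; rewrite negb_or => /andP[->].
have potI v : v \in I -> pot Q' v = l.
  move=> vI; have [XS Xc] := XP v (subsetP IR v vI).
  apply/eqP; rewrite -(eqn_add2l #|X v|) Xc.
  rewrite /pot; set A := (X in _ == #|pred_of_set X|).
  have XA : X v \subset A.
    apply/subsetP => w wX; have [wP wI evw _] := XI v w vI wX.
    rewrite inE evw /=; apply/negP => /Q1[_].
    by rewrite (negPf wP) (negPf (IP _ vI)).
  rewrite -(cardsID (X v) A) (setIidPr XA) eqn_add2l; apply/eqP/eq_card => w.
  rewrite !inE Q'E vI (IP _ vI) /= !negb_or.
  case evw: (e v w) => //=; rewrite ?andbF //.
  have -> : w \in I = false.
    by apply/negP => wI; move: (Iind v w vI wI); rewrite evw.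
  by rewrite /= andbC.
exists I, Q'; split.
- split=> //; split.
  + move=> u v; rewrite Q'E !inE => /or3P[/Q1[-> /orP[]->]|/and4P[-> _ -> _]|].
    * by [].
    * by rewrite !orbT.
    * by rewrite !orbT.
    * by case/andP => vI /(XI _ _ vI)[_ _ evu _]; rewrite es evu vI !orbT.
  + move=> u v euv; rewrite !inE => uv.
    have QQ : (u \in P) || (v \in P) = false -> (((u, v) \in Q) = false) * (((v, u) \in Q) = false).
      by move=> h; split; apply/negP => /Q1[_]; [rewrite h | rewrite orbC h].
    rewrite !Q'E (es v u) euv /=.
    case vP: (v \in P) => /=; last case uP: (u \in P) => /=.
    * have vI : v \in I = false by apply/negP => /IP; rewrite vP.
      have nX x : x \in I -> v \in X x = false.
        by move=> xI; apply/negP => /(XI _ _ xI)[]; rewrite vP.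
      rewrite vI /= andbF /= orbF.
      have -> : (u \in I) && (v \in X u) = false.
        by apply/negP => /andP[/nX ->].
      by rewrite !orbF; apply: Q2; rewrite ?vP ?orbT.
    * have uI : u \in I = false by apply/negP => /IP; rewrite uP.
      have nX x : x \in I -> u \in X x = false.
        by move=> xI; apply/negP => /(XI _ _ xI)[]; rewrite uP.
      rewrite uI /= andbF /= orbF.
      have -> : (v \in I) && (u \in X v) = false.
        by apply/negP => /andP[/nX ->].
      by rewrite !orbF; apply: Q2; rewrite ?uP.
    * have [-> ->] : (((u, v) \in Q) = false) * (((v, u) \in Q) = false).
        by apply: QQ; rewrite uP vP.
      rewrite uP vP /= in uv.
      case uI: (u \in I); case vI: (v \in I) => //=.
      - by move: (Iind u v uI vI); rewrite euv.
      - by case: (v \in X u).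
      - by case: (u \in X v).
      - by rewrite uI vI in uv.
  + move=> u v; rewrite !inE negb_or => /andP[uP uI]; rewrite Q'E (negPf uI) /=.
    case/orP=> [/(Q3 _ _ uP)|]; first by rewrite inE.
    by case/andP => vI /(XI _ _ vI)[_ _ evu ->]; rewrite es evu.
  + move=> u v; rewrite !inE => /orP[uP|uI] /orP[vP|vI] euv.
    * by rewrite !potP // Q4.
    * by rewrite potP // (potI v) // gtn_eqF // Ppot.
    * by rewrite (potP v) // potI // ltn_eqF // Ppot.
    * by move: (Iind u v uI vI); rewrite euv.
- exact: Idom.
- exact: potle.
- move=> v z; rewrite inE negb_or => /andP[vP vI] zI evz vX.
  apply: proper_card; apply/properP; split.
    apply/subsetP => w.
    by rewrite !inE Q'E => /andP[->]; rewrite negb_or => /andP[->].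
  exists z; rewrite !inE evz /=.
    by apply/negP => /Q1[_]; rewrite (negPf vP) (negPf (IP _ zI)).
  by rewrite Q'E zI vP es evz vX orbT.
Qed.

Context {d : nat} (parents_le : forall v, #|parents v| <= d).

(** A vertex of pot at least M always has more children than it has to
    exclude, since M exceeds 2 d and it has at most d parents; so it can be
    ready at each of the levels M, ..., M - d, and each of these either serves
    it or processes a new parent. *)
Lemma rich_phase M i : d.*2 < M -> i <= d.+1 ->
  exists P Q, [/\ partial P Q, forall v, v \in P -> M - i < pot Q v <= M &
    forall v, v \notin P -> M <= pot Q v -> i <= #|parents v :&: P|].
Proof.
move=> dM; elim: i => [_|i IHi id].
  by exists set0, set0; split=> [|v|//]; [split=> u v|]; rewrite !inE.
have [P [Q [pPQ Ppot rich]]] := IHi (ltnW id).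
pose Rd := [set v in ~: P | M <= pot Q v].
have [x|X XP] := @fin_all_exists _ _ (fun x (B : {set T}) => x \in Rd ->
    B \subset children P x /\ #|B| + (M - i) = pot Q x).
  case: (boolP (x \in Rd)) => [|_]; last by exists set0.
  rewrite !inE => /andP[xP Mx].
  have [|B BS Bc] := @subset_of_card _ (children P x) (pot Q x - (M - i)).
    by have := pot_children_le pPQ xP (parents_le x); lia.
  by exists B; split=> //; rewrite Bc; lia.
have [||I [Q' [[pPQ' IR potP potI] dom potle _]]] := level_step pPQ _ _ XP.
- by move=> v /Ppot/andP[].
- by apply/subsetP => v; rewrite inE => /andP[].
exists (P :|: I), Q'; split=> //.
- move=> v; rewrite inE => /orP[vP|vI]; last by rewrite potI //; lia.
  by rewrite potP //; have := Ppot v vP; lia.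
- move=> v; rewrite inE negb_or => /andP[vP vI] Mv.
  have Mv' := leq_trans Mv (potle v vP).
  have vR : v \in Rd by rewrite !inE vP.
  have [z zI zv] := dom v vR vI.
  apply: leq_ltn_trans (rich v vP Mv') _.
  apply: proper_card; apply/properP; split; first by rewrite setIS ?subsetUl.
  exists z; first by rewrite in_setI zv in_setU zI orbT.
  have := subsetP IR z zI.
  by rewrite in_setI inE in_setC => /andP[/negPf-> _]; rewrite andbF.
Qed.

(** The potential that bounds the kill phase: it grows at each level at which a
    ready vertex v is served or is blocked by a parent. *)
Definition resolved P v := #|P :&: (v |: parents v)|.

(** Readiness is defined from the last vertex down: x is ready when its pot is
    at least l and the children it must exclude can be taken among those that
    are not ready.  No ready vertex is then excluded, so a ready vertex of pot
    exactly l that is blocked drops below l.  A vertex of pot above l that is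
    not ready has, by definition, few children that are not ready, hence many
    ready ones, and all those are resolved further. *)
Lemma ready_step P Q l : partial P Q -> (forall v, v \in P -> l < pot Q v) ->
  exists P' Q', [/\ partial P' Q', P \subset P',
    forall v, v \in P' -> pot Q' v = if v \in P then pot Q v else l,
    forall v, v \notin P' -> pot Q' v <= pot Q v /\ (pot Q v = l -> pot Q' v < l) &
    forall v, v \notin P' -> l < pot Q v ->
      #|parents v :&: P| < #|parents v :&: P'| \/
      l < #|[set y in children P v | resolved P y < resolved P' y]| + d].
Proof.
move=> pPQ Ppot; pose K := \max_x rk x.
have rkK x : rk x <= K by apply: leq_bigmax.
(* K - rk reverses the order, so that children come before parents. *)
have [Rd RdE] : exists Rd : {set T}, forall x, (x \in Rd) =
    [&& x \notin P, l <= pot Q x & pot Q x <= #|children P x :\: Rd| + l].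
  have [Rd RdE] := rec_set (fun x => K - rk x) (fun x S =>
    [&& x \notin P, l <= pot Q x & pot Q x <= #|children P x :\: S| + l]).
  exists Rd => x; rewrite RdE; congr [&& _, _ & _ <= _ + _]; apply: eq_card => y.
  rewrite !inE; case: (ltnP (rk x) (rk y)) => [xy|]; last by rewrite !andbF.
  by rewrite [K - _ < _](_ : _ = true) ?andbT //; have := rkK y; lia.
have [x|X XP] := @fin_all_exists _ _ (fun x (B : {set T}) => x \in Rd ->
    B \subset children P x :\: Rd /\ #|B| + l = pot Q x).
  case: (boolP (x \in Rd)) => [|_]; last by exists set0.
  rewrite RdE => /and3P[xP lx xl].
  have [|B BS Bc] := @subset_of_card _ (children P x :\: Rd) (pot Q x - l).
    by lia.
  by exists B; split=> //; rewrite Bc; lia.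
have [||I [Q' [[pPQ' IR potP potI] dom potle potlt]]] :=
    @level_step P Q l Rd X pPQ Ppot.
- by apply/subsetP => v; rewrite RdE inE => /and3P[].
- move=> x /XP[BS ->]; split=> //; apply: subset_trans BS _; exact: subsetDl.
have XRd v z : v \in Rd -> z \in I -> v \notin X z.
  move=> vR zI; apply/negP => vX.
  by have [/subsetP/(_ v vX)] := XP z (subsetP IR z zI); rewrite inE vR.
have IP z : z \in I -> z \notin P.
  by move/(subsetP IR); rewrite RdE => /and3P[].
exists (P :|: I), Q'; split=> //; first exact: subsetUl.
- move=> v; rewrite inE; case: ifPn => [vP _|vP /= vI]; first exact: potP.
  exact: potI.
- move=> v vPI; move: (vPI); rewrite inE negb_or => /andP[vP vI]; split.
    exact: potle.
  move=> vl; have vR : v \in Rd by rewrite RdE vP vl leqnn leq_addl.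
  have [z zI] := dom v vR vI; rewrite inE => /andP[evz _].
  by rewrite -vl; apply: potlt evz (XRd v z vR zI).
- move=> v; rewrite inE negb_or => /andP[vP vI] lv.
  case: (boolP (v \in Rd)) => vR; [left|right].
    have [z zI zv] := dom v vR vI.
    apply: proper_card; apply/properP; split; first by rewrite setIS ?subsetUl.
    exists z; first by rewrite in_setI zv in_setU zI orbT.
    by rewrite in_setI (negPf (IP z zI)) andbF.
  have : #|children P v :\: Rd| + l < pot Q v.
    by move: vR; rewrite RdE vP (ltnW lv) /= -ltnNge.
  move=> /leq_trans /(_ (pot_children_le pPQ vP (parents_le v))).
  rewrite -(cardsID Rd (children P v)) => h.
  suff : #|children P v :&: Rd| <=
      #|[set y in children P v | resolved P y < resolved (P :|: I) y]| by lia.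
  apply: subset_leq_card; apply/subsetP => y /setIP[yc yR].
  rewrite in_set yc /=; apply: proper_card; apply/properP; split.
    by rewrite setSI ?subsetUl.
  case: (boolP (y \in I)) => [yI|/(dom y yR)[z zI zy]].
    exists y; first by rewrite in_setI in_setU yI orbT setU11.
    by rewrite in_setI (negPf (IP y yI)).
  exists z; first by rewrite in_setI in_setU zI orbT in_setU zy orbT.
  by rewrite in_setI (negPf (IP z zI)).
Qed.

(** A vertex is dirty when its pot exceeds the level.  At level 6 d - i a dirty
    vertex that is not served sees its potential, weighted as shown, grow by at
    least 5 d + 1 - i = (6 d - i) - d + 1. *)
Lemma kill_phase P0 Q0 s : partial P0 Q0 ->
  (forall v, v \in P0 -> 6 * d < pot Q0 v <= 7 * d + 1) -> s <= 4 * d ->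
  exists P Q, [/\ partial P Q, P0 \subset P,
    forall v, v \in P -> 6 * d - s < pot Q v <= 7 * d + 1 &
    forall v, v \notin P -> pot Q v <= 6 * d - s \/
      \sum_(i < s) (5 * d + 1 - i) <=
      \sum_(y in children P0 v) resolved P y + #|parents v :&: P| * (5 * d + 1)].
Proof.
move=> pPQ0 Ppot0; elim: s => [_|s IHs s4].
  exists P0, Q0; split=> // [v /Ppot0|v _]; first by rewrite subn0.
  by right; rewrite big_ord0.
have [P [Q [pPQ P0P Ppot dirty]]] := IHs (ltnW s4).
have [|P' [Q' [pPQ' PP' Ppot' potle blocked]]] := @ready_step P Q (6 * d - s) pPQ.
  by move=> v /Ppot/andP[].
exists P', Q'; split=> //; first exact: subset_trans PP'.
  move=> v vP'; rewrite Ppot' //; case: ifPn => [/Ppot|_]; lia.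
move=> v vP'; have vP : v \notin P by apply: contra vP'; apply: (subsetP PP').
have [le_pot lt_pot] := potle v vP'.
have resolved_le y : resolved P y <= resolved P' y.
  by apply: subset_leq_card; rewrite setSI.
have par_le : #|parents v :&: P| <= #|parents v :&: P'|.
  by apply: subset_leq_card; rewrite setIS.
have [clean|] := leqP (pot Q v) (6 * d - s).
  by left; move: lt_pot; case: (eqVneq (pot Q v) (6 * d - s)) => [-> /(_ erefl)|ne _]; lia.
move=> dirtyv; right; rewrite big_ord_recr /=.
have [|old] := dirty v vP; first by lia.
have := blocked v vP' dirtyv; set Y := [set _ in _ | _] => newb.
have YS : \sum_(y in children P0 v) resolved P y + #|Y| <=
    \sum_(y in children P0 v) resolved P' y.
  rewrite -sum1_card (big_setID Y) /= [in leqRHS](big_setID Y) /=.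
  have -> : children P0 v :&: Y = Y.
    apply/setIidPr/subsetP => y; rewrite !inE => /andP[/and3P[yP -> ->] _].
    by rewrite !andbT; apply: contra yP; apply: (subsetP P0P).
  rewrite addnAC -big_split leq_add //=; last by apply: leq_sum.
  by apply: leq_sum => y; rewrite inE addn1 => /andP[].
case: newb => [newp|newY]; last first.
  have leY : 5 * d + 1 - s <= #|Y| by lia.
  apply: leq_trans (leq_add old leY) _.
  by rewrite addnAC leq_add // leq_mul.
apply: leq_trans (leq_add old (leq_subr s _)) _.
by rewrite -addnA leq_add ?leq_sum // -mulSnr leq_mul.
Qed.

Lemma sum_consecutive m s : s <= m ->
  (\sum_(i < s) (m - i)) * 2 + s * s = s * (m.*2 + 1).
Proof.
elim: s => [|s IHs] sm; first by rewrite big_ord0.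
move: (IHs (ltnW sm)); rewrite big_ord_recr /=.
by move: (\sum_(i < s) _) => A; nia.
Qed.

(** An unprocessed v is a parent of each of its children, so each child is
    resolved at most d times out of d + 1; this bounds the left side by
    7 d * d + d (5 d + 1) = 12 d ^ 2 + d, while the right side is
    12 d ^ 2 + 6 d. *)
Lemma no_dirty_left P0 Q0 P v : 0 < d -> partial P0 Q0 -> v \notin P ->
  P0 \subset P -> pot Q0 v <= 7 * d ->
  \sum_(y in children P0 v) resolved P y + #|parents v :&: P| * (5 * d + 1) <
  \sum_(i < 4 * d) (5 * d + 1 - i).
Proof.
move=> d0 pPQ0 vP P0P pot0.
have vP0 : v \notin P0 by apply: contra vP; apply: (subsetP P0P).
have res_le y : y \in children P0 v -> resolved P y <= d.
  rewrite !inE => /and3P[_ evy vy].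
  have vpar : v \in y |: parents y by rewrite !inE es evy vy orbT.
  rewrite -ltnS; apply: leq_trans (_ : resolved P y < #|y |: parents y|) _.
    apply: proper_card; apply/properP; split; first exact: subsetIr.
    by exists v; rewrite // inE (negPf vP).
  by rewrite cardsU1 -add1n leq_add // leq_b1.
have sum_le : \sum_(y in children P0 v) resolved P y <= 7 * d * d.
  apply: (@leq_trans (\sum_(y in children P0 v) d)); first exact: leq_sum.
  rewrite sum_nat_const leq_mul2r.
  by rewrite (leq_trans (children_pot pPQ0 vP0) pot0) orbT.
have par_le : #|parents v :&: P| <= d.
  by apply: leq_trans (parents_le v); apply: subset_leq_card; apply: subsetIl.
have := @sum_consecutive (5 * d + 1) (4 * d).
move: sum_le par_le; move: (\sum_(_ in _) _) (\sum_(_ < _) _) #|_| => A B p.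
nia.
Qed.

Lemma proper_of_partial P Q M : partial P Q -> (forall v, v \in P) ->
  (forall v, pot Q v <= M) -> proper_orientation e Q /\ max_outdeg Q <= M.
Proof.
move=> [Q1 Q2 Q3 Q4] PT potM.
have outE v : outdeg Q v = pot Q v.
  apply: eq_card => w; rewrite !inE; case evw: (e v w) => /=.
    have := Q2 v w evw; rewrite PT => /(_ isT).
    by case: ((v, w) \in Q); case: ((w, v) \in Q).
  by apply/negP => /Q1[]; rewrite evw.
split; last by apply/bigmax_leqP => v _; rewrite outE.
apply/andP; split; apply/forallP => u; apply/forallP => v.
  case: ifPn => [euv|]; first by apply: Q2; rewrite ?PT.
  by apply: contra => /Q1[].
by apply/implyP => euv; rewrite !outE Q4.
Qed.

(** Once no unprocessed pot exceeds the level, [ready_step] keeps it so, and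
    after level 0 an unprocessed vertex would have a negative pot. *)
Lemma clean_phase M l P Q : l < M -> partial P Q ->
  (forall v, v \in P -> l < pot Q v <= M) ->
  (forall v, v \notin P -> pot Q v <= l) ->
  exists2 Q', proper_orientation e Q' & max_outdeg Q' <= M.
Proof.
elim: l P Q => [|l IHl] P Q lM pPQ Ppot clean;
  have [P' [Q' [pPQ' PP' Ppot' potle _]]] :=
    ready_step pPQ (fun v vP => (andP (Ppot v vP)).1).
- have P'T v : v \in P'.
    apply/negPn/negP => vP'; have [_] := potle v vP'.
    have vP : v \notin P by apply: contra vP'; apply: (subsetP PP').
    have := clean v vP; rewrite leqn0 => /eqP pot0 /(_ pot0).
    by rewrite ltn0.
  have [] := @proper_of_partial P' Q' M pPQ' P'T; last by exists Q'.
  by move=> v; rewrite Ppot' //; case: ifP => // /Ppot/andP[].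
- apply: (IHl P' Q') => // [|v vP'|v vP']; first exact: ltnW.
    by rewrite Ppot' //; case: ifP => [/Ppot|_]; lia.
  have vP : v \notin P by apply: contra vP'; apply: (subsetP PP').
  have [] := potle v vP'; have := clean v vP.
  by case: (eqVneq (pot Q v) l.+1) => [-> _ _ /(_ erefl)|ne le1 le2 _]; lia.
Qed.

Lemma proper_orientation_of_order : 0 < d ->
  exists2 Q, proper_orientation e Q & max_outdeg Q <= 7 * d + 1.
Proof.
move=> d0.
have [|//|P0 [Q0 [pPQ0 Ppot0 rich]]] := @rich_phase (7 * d + 1) d.+1; first by lia.
have pot0 v : v \notin P0 -> pot Q0 v <= 7 * d.
  move=> vP0; rewrite leqNgt; apply/negP => big.
  have := rich v vP0; rewrite addn1 => /(_ big); apply/negP; rewrite -leqNgt.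
  by apply: leq_trans (parents_le v); apply: subset_leq_card; apply: subsetIl.
have [v /Ppot0|P [Q [pPQ P0P Ppot dirty]]] := kill_phase pPQ0 _ (leqnn (4 * d)).
  lia.
apply: (@clean_phase (7 * d + 1) (2 * d) P Q) => // [|v /Ppot|v vP]; [lia|lia|].
have vP0 : v \notin P0 by apply: contra vP; apply: (subsetP P0P).
have [|] := dirty v vP; first by lia.
by rewrite leqNgt (no_dirty_left d0 pPQ0 vP P0P (pot0 v vP0)).
Qed.

End Levels.

Lemma degenerate_order (T : finType) (e : rel T) d :
  (forall S : {set T}, S != set0 ->
     exists2 v, v \in S & #|[set w in S | e v w]| <= d) ->
  exists2 rk : T -> nat, injective rk &
    forall v, #|[set w | e v w & rk w < rk v]| <= d.
Proof.
move=> deg.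
suff [rk rkb [rk_inj rkd]] : exists2 rk : T -> nat,
    {in [set: T], forall v, rk v < #|T|} &
    {in [set: T] &, injective rk} /\ {in [set: T], forall v,
       #|[set w in [set: T] | e v w && (rk w < rk v)]| <= d}.
  exists rk => [x y|v]; first by apply: rk_inj; rewrite inE.
  rewrite (leq_trans _ (rkd v _)) ?inE // subset_leq_card //.
  by apply/subsetP => w; rewrite !inE.
rewrite -cardsT; move: {-1}#|_| (erefl #|[set: T]|) => n.
elim: n [set: T] => [|n IHn] S Sn.
  have -> : S = set0 by apply/eqP; rewrite -cards_eq0 Sn.
  by exists (fun=> 0); [move=> v; rewrite inE | split=> v; rewrite inE].
have [|v vS vd] := deg S; first by rewrite -card_gt0 Sn.
have [|rk rkb [rk_inj rkd]] := IHn (S :\ v).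
  by apply/eqP; rewrite -eqSS -Sn (cardsD1 v S) vS.
exists (fun w => if w == v then n else rk w); [|split].
- move=> w wS; case: eqVneq => // wv; rewrite ltnW // ltnS rkb //.
  by rewrite !inE wv.
- move=> x y xS yS; have rkS z : z \in S -> z != v -> rk z < n.
    by move=> zS zv; apply: rkb; rewrite !inE zv.
  case: (eqVneq x v) (eqVneq y v) => [->|xv] [->|yv] //.
  + by move=> h; have := rkS y yS yv; rewrite h ltnn.
  + by move=> h; have := rkS x xS xv; rewrite h ltnn.
  + by apply: rk_inj; rewrite !inE ?xv ?yv.
- move=> w wS; case: (eqVneq w v) => [->|wv].
    apply: leq_trans vd; apply: subset_leq_card; apply/subsetP => x.
    by rewrite !inE => /and3P[-> ->].
  apply: leq_trans (rkd w _); last by rewrite !inE wv.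
  apply: subset_leq_card; apply/subsetP => x; rewrite !inE.
  case: eqVneq => //= _ /and3P[_ _].
  by have := rkb w; rewrite !inE wv wS => /(_ isT); lia.
Qed.

Lemma proper_orientation_number_degenerate (T : finType) (e : rel T) d :
  symmetric e -> irreflexive e -> 0 < d ->
  (forall S : {set T}, S != set0 ->
     exists2 v, v \in S & #|[set w in S | e v w]| <= d) ->
  proper_orientation_number e <= 7 * d + 1.
Proof.
move=> es ei d0 /degenerate_order[rk rk_inj rkd].
have [Q pQ Qd] := proper_orientation_of_order es ei rk_inj rkd d0.
by have [_ /(_ Q pQ) /leq_trans] := proper_orientation_number_attained es ei; apply.
Qed.

(** * Minors of 2-complexes over the two-element field *)

Import Order.TTheory GRing.Theory Num.Theory.
Local Open Scope ring_scope.

Lemma addF2xx (x : 'F_2) : x + x = 0.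
Proof. by case: x => [[|[|//]] i]; apply/val_inj. Qed.

Lemma F2_neq0 (x : 'F_2) : x != 0 -> x = 1.
Proof. by case: x => [[|[|//]] i] // _; apply/val_inj. Qed.

Lemma F2_addr_eq0 (x y : 'F_2) : x + y = 0 -> x = y.
Proof. by move=> xy; rewrite -[x]addr0 -(addF2xx y) addrA xy add0r. Qed.

Lemma F2_cancel (x u w : 'F_2) : x + u + (u + w) = x + w.
Proof. by rewrite addrA -(addrA x) addF2xx addr0. Qed.

Lemma card_F2fun (A : finType) : #|{ffun A -> 'F_2}| = (2 ^ #|A|)%N.
Proof. by rewrite card_ffun card_ord. Qed.

Lemma card_le_fibers (A B : finType) (f : A -> B) c :
  (forall y, (#|[set x | f x == y]| <= c)%N) -> (#|A| <= #|B| * c)%N.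
Proof.
move=> fc; rewrite -cardsT -sum1_card (partition_big f predT) //=.
rewrite -sum_nat_const; apply: leq_sum => y _; apply: leq_trans (fc y).
by rewrite -sum1_card; under [leqRHS]eq_bigl do rewrite inE; under eq_bigl do rewrite inE.
Qed.

(** A 2-complex given by the ends a, b of its edges and by the faces l, r on
    their two sides; chains have coefficients in the two-element field. *)
Section Complex.
Context {V E F : finType} (a b : E -> V) (l r : E -> F).

Definition inc (eps : E) (x : V) : 'F_2 := (a eps == x)%:R + (b eps == x)%:R.
Definition bdry1 (z : E -> 'F_2) (x : V) : 'F_2 := \sum_eps z eps * inc eps x.
Definition bdry2 (s : F -> 'F_2) (eps : E) : 'F_2 := s (l eps) + s (r eps).

Definition adj (x y : V) : bool :=
  [exists eps, ((a eps == x) && (b eps == y)) || ((a eps == y) && (b eps == x))].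

(** Connectedness of the subgraph induced on S, as the absence of a proper
    nonempty closed part: the form in which it is both produced from
    topological connectedness and used. *)
Definition conn (S : {set V}) := forall A : {set V}, A \subset S -> A != set0 ->
  (forall x y, x \in A -> y \in S -> adj x y -> y \in A) -> A = S.

Lemma adj_sym : symmetric adj.
Proof. by move=> x y; apply: eq_existsb => eps; rewrite orbC. Qed.

Lemma bdry1D z z' x : bdry1 (fun eps => z eps + z' eps) x = bdry1 z x + bdry1 z' x.
Proof. by rewrite -big_split; apply: eq_bigr => eps _; rewrite mulrDl. Qed.

Lemma bdry1_delta eps x : bdry1 (fun eps' => (eps' == eps)%:R) x = inc eps x.
Proof.
rewrite /bdry1 (bigD1 eps) //= eqxx mul1r big1 ?addr0 // => i /negPf->.
by rewrite mul0r.
Qed.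

(** A path from x to y inside S, recorded by the parity of its use of each
    edge. *)
Lemma conn_chain S x y : conn S -> x \in S -> y \in S ->
  exists p : {ffun E -> 'F_2},
    (forall eps, p eps != 0 -> (a eps \in S) && (b eps \in S)) /\
    forall w, bdry1 p w = (x == w)%:R + (y == w)%:R.
Proof.
move=> cS xS yS.
pose ok y (p : {ffun E -> 'F_2}) :=
  [forall eps, (p eps != 0) ==> (a eps \in S) && (b eps \in S)] &&
  [forall w, bdry1 p w == (x == w)%:R + (y == w)%:R].
suff AS : [set y in S | [exists p, ok y p]] = S.
  move: yS; rewrite -{1}AS inE => /andP[_ /existsP[p /andP[/forallP p1 /forallP p2]]].
  by exists p; split=> [eps|w]; [apply/implyP; exact: p1 | apply/eqP; exact: p2].
apply: cS.
- by apply/subsetP => w; rewrite inE => /andP[].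
- apply/set0Pn; exists x; rewrite inE xS; apply/existsP; exists [ffun=> 0].
  apply/andP; split; apply/forallP => w; first by rewrite ffunE eqxx.
  by rewrite addF2xx /bdry1 big1 // => eps _; rewrite ffunE mul0r.
- move=> u w; rewrite !inE => /andP[uS /existsP[p /andP[/forallP p1 /forallP p2]]] wS.
  case/existsP => eps epsP; rewrite wS; apply/existsP.
  exists [ffun eps' => p eps' + (eps' == eps)%:R]; apply/andP; split; apply/forallP => v.
    rewrite ffunE; apply/implyP; case: (eqVneq v eps) => [->|_].
      by move=> _; case/orP: epsP => /andP[/eqP-> /eqP->]; rewrite uS wS.
    by rewrite addr0; apply/implyP; exact: p1.
  have -> : bdry1 [ffun eps' => p eps' + (eps' == eps)%:R] v =
      bdry1 (fun eps' => p eps' + (eps' == eps)%:R) v.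
    by apply: eq_bigr => i _; rewrite ffunE.
  rewrite bdry1D bdry1_delta (eqP (p2 v)) /inc.
  case/orP: epsP => /andP[/eqP-> /eqP->].
    by rewrite F2_cancel.
  by rewrite [X in _ + X]addrC F2_cancel.
Qed.

End Complex.

(** The edges d of a simple loopless graph on T, with ends g d and h d, realized
    in the complex by disjoint connected branch sets B u and by edges kappa d
    that join them. *)
Section BranchSets.
Context {V E F : finType} {a b : E -> V} {l r : E -> F} {ell : nat}.
Context {Lam : {ffun 'I_ell -> 'F_2} -> E -> 'F_2}.
Context (bdry_bdry : forall (s : F -> 'F_2) x, bdry1 a b (bdry2 l r s) x = 0).
Context (homology : forall z, (forall x, bdry1 a b z x = 0) ->
  exists (s : F -> 'F_2) t, forall eps, z eps = bdry2 l r s eps + Lam t eps).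

Context {T D : finType} {g h : D -> T}.
Context (loopless : forall d, g d != h d).
Context (simple : forall d d', (g d == g d') && (h d == h d') ||
  (g d == h d') && (h d == g d') -> d = d').
Context {B : T -> {set V}} {kappa : D -> E}.
Context (Bdisj : forall u v x, x \in B u -> x \in B v -> u = v).
Context (Bconn : forall u, conn a b (B u)).
Context (Bn0 : forall u, B u != set0).
Context (kappaP : forall d, (a (kappa d) \in B (g d)) && (b (kappa d) \in B (h d))
  || (a (kappa d) \in B (h d)) && (b (kappa d) \in B (g d))).

Let intra eps := [exists u, (a eps \in B u) && (b eps \in B u)].
Let inH eps := intra eps || [exists d, kappa d == eps].
(* Incidence in the graph, as opposed to [inc] in the complex. *)
Let incT d u : 'F_2 := (g d == u)%:R + (h d == u)%:R.

Let mem_eq u v x : x \in B u -> (x \in B v) = (u == v).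
Proof.
move=> xu; apply/idP/eqP => [|<-//]; exact: Bdisj.
Qed.

Let kappa_inc d u : (a (kappa d) \in B u)%:R + (b (kappa d) \in B u)%:R = incT d u.
Proof.
case/orP: (kappaP d) => /andP[ad bd]; rewrite (mem_eq _ ad) (mem_eq _ bd) //.
by rewrite addrC.
Qed.

Let kappa_intra d : ~~ intra (kappa d).
Proof.
apply/existsPn => u; apply/negP => /andP[au bu].
case/orP: (kappaP d) => /andP[ad bd]; move: (loopless d);
  by rewrite (Bdisj ad au) (Bdisj bd bu) eqxx.
Qed.

Let kappa_inj : injective kappa.
Proof.
move=> d d' dd'; apply: simple.
have := kappaP d; rewrite dd'; case/orP: (kappaP d') => /andP[ad bd].
  case/orP => /andP[ad' bd'].
    by rewrite (Bdisj ad' ad) (Bdisj bd' bd) !eqxx.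
  by rewrite (Bdisj ad' ad) (Bdisj bd' bd) !eqxx orbT.
case/orP => /andP[ad' bd'].
  by rewrite (Bdisj ad' ad) (Bdisj bd' bd) !eqxx orbT.
by rewrite (Bdisj ad' ad) (Bdisj bd' bd) !eqxx.
Qed.

Let hub u : exists x, x \in B u. Proof. exact/set0Pn. Qed.

(** Lifts an edge of the graph to a path of the complex between chosen points of
    the two branch sets; the path uses no other edge kappa d', so lifting keeps
    independent chains independent. *)
Let edge_chain (c : T -> V) (cB : forall u, c u \in B u) d :
  exists p : {ffun E -> 'F_2}, [/\ forall eps, p eps != 0 -> inH eps,
    forall d', p (kappa d') = (d == d')%:R &
    forall x, bdry1 a b p x = (c (g d) == x)%:R + (c (h d) == x)%:R].
Proof.
have [x [y [xg yh kxy]]] : exists x y, [/\ x \in B (g d), y \in B (h d) &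
    forall w, inc a b (kappa d) w = (x == w)%:R + (y == w)%:R].
  case/orP: (kappaP d) => /andP[ad bd].
    by exists (a (kappa d)), (b (kappa d)); split.
  by exists (b (kappa d)), (a (kappa d)); split=> // w; rewrite addrC.
have [p [p1 p2]] := conn_chain (@Bconn (g d)) (cB (g d)) xg.
have [q [q1 q2]] := conn_chain (@Bconn (h d)) (cB (h d)) yh.
have pintra eps : p eps != 0 -> intra eps by move/p1 => ?; apply/existsP; exists (g d).
have qintra eps : q eps != 0 -> intra eps by move/q1 => ?; apply/existsP; exists (h d).
exists [ffun eps => (eps == kappa d)%:R + (p eps + q eps)]; split.
- move=> eps; rewrite ffunE; apply: contraNT; rewrite negb_or => /andP[nin nk].
  have -> : p eps = 0 by apply/eqP; apply: contraNT nin => /pintra.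
  have -> : q eps = 0 by apply/eqP; apply: contraNT nin => /qintra.
  rewrite [eps == _](_ : _ = false) ?addr0 //; apply: contraNF nk => /eqP->.
  by apply/existsP; exists d.
- move=> d'; rewrite ffunE (inj_eq kappa_inj) eq_sym.
  have -> : p (kappa d') = 0.
    by apply/eqP; apply: contraNT (kappa_intra d') => /pintra.
  have -> : q (kappa d') = 0.
    by apply/eqP; apply: contraNT (kappa_intra d') => /qintra.
  by rewrite !addr0.
- move=> w; transitivity (inc a b (kappa d) w + (bdry1 a b p w + bdry1 a b q w)).
    rewrite -bdry1_delta -!bdry1D; apply: eq_bigr => eps _; by rewrite ffunE.
  by rewrite kxy p2 q2 [X in _ + X]addrACA [X in _ + X]addrC [LHS]addrA addF2xx add0r.
Qed.

Let dual f f' := [exists eps, ~~ inH eps &&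
  (((l eps == f) && (r eps == f')) || ((l eps == f') && (r eps == f)))].

Let dual_sym : connect_sym dual.
Proof.
apply: sym_connect_sym => f f'; apply: eq_existsb => eps; by rewrite orbC.
Qed.

(** Regions are the classes of faces that can be reached from one another
    without crossing the branch sets or the edges kappa d. *)
Let region := fingraph.root dual.

Let region_lr eps : ~~ inH eps -> region (l eps) = region (r eps).
Proof.
move=> nH; apply/(fingraph.rootP dual_sym)/connect1/existsP; exists eps.
by rewrite nH !eqxx.
Qed.

Let constant_on_regions (s : F -> 'F_2) :
  (forall eps, ~~ inH eps -> bdry2 l r s eps = 0) -> forall f, s f = s (region f).
Proof.
move=> s0 f; have /connectP[p] := connect_root dual f; rewrite -/region => pth ->.
elim: p f pth => //= f' p IHp f /andP[/existsP[eps /andP[nH lr]] /IHp <-].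
by case/orP: lr (F2_addr_eq0 (s0 eps nH)) => /andP[/eqP<- /eqP<-].
Qed.

Let borders c d := (region (l (kappa d)) == c) (+) (region (r (kappa d)) == c).
Let border c := [set d | borders c d].
Let regions := [set c | border c != set0].

(** The boundary of a region is a cycle of the complex; contracting each branch
    set to a point turns it into a cycle of the graph. *)
Let border_cycle c u : \sum_(d in border c) incT d u = 0.
Proof.
pose s f : 'F_2 := (region f == c)%:R.
have sE eps : bdry2 l r s eps = ((region (l eps) == c) (+) (region (r eps) == c))%:R.
  rewrite /bdry2 /s; case: (region (l eps) == c); case: (region (r eps) == c);
      by rewrite /= ?addr0 ?add0r ?addF2xx.
have : \sum_(x in B u) bdry1 a b (bdry2 l r s) x = 0.
  by rewrite big1 // => x _; exact: bdry_bdry.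
rewrite exchange_big /= => sum0; rewrite -[RHS]sum0.
have incS eps : \sum_(x in B u) inc a b eps x =
    (a eps \in B u)%:R + (b eps \in B u)%:R :> 'F_2.
  have one x : \sum_(y in B u) (x == y)%:R = (x \in B u)%:R :> 'F_2.
    case: (boolP (x \in B u)) => xu.
      rewrite (bigD1 x) //= eqxx big1 ?addr0 // => y /andP[_].
      by rewrite eq_sym => /negPf->.
    rewrite big1 // => y yu; case: eqP => // xy; by rewrite xy yu in xu.
  by rewrite big_split /= !one.
under [RHS]eq_bigr do rewrite -mulr_sumr incS.
rewrite [RHS](bigID (mem [set kappa d | d in [set: D]])) /=.
rewrite [X in _ = _ + X]big1 ?addr0 => [|eps nk].
  rewrite [RHS]big_imset /=; last by move=> d d' _ _; apply: kappa_inj.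
  rewrite big_mkcond [RHS]big_mkcond /=; apply: eq_bigr => d _.
  rewrite kappa_inc sE !inE /borders.
  by case: (_ (+) _); rewrite ?mul1r ?mul0r.
have [inh|/region_lr nH] := boolP (inH eps); last by rewrite sE nH addbb mul0r.
case/orP: inh => [/existsP[v /andP[av bv]]|/existsP[d /eqP kd]].
  by rewrite (mem_eq _ av) (mem_eq _ bv) addF2xx mulr0.
by move: nk; rewrite -kd imset_f.
Qed.

(** From an edge d1 of the border, follow the cycle at both of its ends: two
    further edges, which differ because the graph is simple. *)
Let border_ge3 c : c \in regions -> (2 < #|border c|)%N.
Proof.
rewrite inE => /set0Pn[d1 d1c].
have other u : incT d1 u != 0 -> exists d, [/\ d \in border c, d != d1 & incT d u != 0].
  move=> d1u; suff /existsP[d /and3P[dc dd1 du]] :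
    [exists d, [&& d \in border c, d != d1 & incT d u != 0]] by exists d.
  apply: contraNT d1u; rewrite negb_exists => /forallP no.
  have := border_cycle c u; rewrite (bigD1 d1) //= big1 ?addr0 => [->//|d].
  by case/andP=> dc dd1; move: (no d); rewrite dc dd1 /= negbK => /eqP.
have inc_g d : incT d (g d) != 0 by rewrite /incT eqxx [h d == _]eq_sym (negPf (loopless d)) addr0.
have inc_h d : incT d (h d) != 0 by rewrite /incT eqxx (negPf (loopless d)) add0r.
have incE d u : incT d u != 0 -> (g d == u) || (h d == u).
  by rewrite /incT; case: (g d == u); case: (h d == u); rewrite //= addr0 eqxx.
have [d2 [d2c d21 /incE d2g]] := other _ (inc_g d1).
have [d3 [d3c d31 /incE d3h]] := other _ (inc_h d1).
have d23 : d2 != d3.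
  apply: contraNneq d21 => d23; rewrite -d23 in d3h.
  apply/eqP/simple; case/orP: d2g => /eqP dg; case/orP: d3h => /eqP dh.
  - by move: (loopless d1); rewrite -dg dh eqxx.
  - by rewrite dg dh !eqxx.
  - by rewrite dg dh !eqxx orbT.
  - by move: (loopless d1); rewrite -dg dh eqxx.
have : [set d1; d2; d3] \subset border c.
  by apply/subsetP => d; rewrite !in_setU !in_set1 => /orP[/orP[]|] /eqP->.
move/subset_leq_card; apply: leq_trans.
by rewrite setUC cardsU1 cards2 !inE negb_or d31 eq_sym d23 eq_sym d21.
Qed.

Let regions_le : (3 * #|regions| <= 2 * #|D|)%N.
Proof.
apply: (@leq_trans (\sum_(c in regions) #|border c|)).
  by rewrite mulnC -sum_nat_const; apply: leq_sum => c; apply: border_ge3.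
under eq_bigr do rewrite -sum1_card big_mkcond.
rewrite exchange_big /= mulnC -sum_nat_const; apply: leq_sum => d _.
rewrite -big_mkcondr sum1_card /=.
apply: (@leq_trans #|[set region (l (kappa d)); region (r (kappa d))]|).
  apply: subset_leq_card; apply/subsetP => c; rewrite inE => /andP[_].
  rewrite !inE /borders ![_ == c]eq_sym.
  by case: (c == _) => //; case: (c == _).
by rewrite cards2; case: eqP.
Qed.

(** All chains z of the graph are counted.  Two chains with the same boundary
    and the same letter coefficients (of z minus a reference chain with the
    same boundary) differ by a sum of region borders.  Hence
    2 ^ #|D| <= 2 ^ #|T| * 2 ^ ell * 2 ^ #|regions|, and three times the number
    of regions is at most twice the number of edges. *)
Lemma branch_sets_edge_bound : (#|D| <= 3 * (#|T| + ell))%N.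
Proof.
have [c cB] := fin_all_exists hub.
have [P PP] := fin_all_exists (edge_chain cB).
pose lift (z : {ffun D -> 'F_2}) eps := \sum_d z d * P d eps.
pose dT (z : {ffun D -> 'F_2}) := [ffun u => \sum_d z d * incT d u].
have lift_cycle z : dT z = 0 -> forall x, bdry1 a b (lift z) x = 0.
  move=> z0 x; transitivity (\sum_u (c u == x)%:R * dT z u); last first.
    by rewrite z0 big1 // => u _; rewrite ffunE mulr0.
  have dTE u : (c u == x)%:R * dT z u = \sum_d z d * ((c u == x)%:R * incT d u).
    by rewrite ffunE mulr_sumr; apply: eq_bigr => d _; rewrite mulrCA.
  under [RHS]eq_bigr do rewrite dTE.
  rewrite exchange_big /= /bdry1 /lift /=.
  under eq_bigr do rewrite mulr_suml.
  rewrite exchange_big /=; apply: eq_bigr => d _.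
  under eq_bigr do rewrite -mulrA.
  rewrite -!mulr_sumr -/(bdry1 a b (P d) x); have [_ _ ->] := PP d.
  congr (_ * _); rewrite /incT; under eq_bigr do rewrite mulrDr.
  rewrite big_split /=; congr (_ + _).
    rewrite (bigD1 (g d)) //= eqxx mulr1 big1 ?addr0 // => u.
    by rewrite eq_sym => /negPf->; rewrite mulr0.
  rewrite (bigD1 (h d)) //= eqxx mulr1 big1 ?addr0 // => u.
  by rewrite eq_sym => /negPf->; rewrite mulr0.
have ex_t z : exists t : {ffun 'I_ell -> 'F_2}, dT z = 0 ->
    exists s, forall eps, lift z eps = bdry2 l r s eps + Lam t eps.
  case: (eqVneq (dT z) 0) => [z0|nz]; last first.
    by exists [ffun=> 0] => z0; rewrite z0 eqxx in nz.
  have [s [t st]] := homology (lift_cycle z z0).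
  by exists t => _; exists s.
have [t tP] := fin_all_exists ex_t.
(* A reference chain with boundary delta, if there is a chain with that boundary. *)
pose base delta := odflt 0 [pick z | dT z == delta].
have dTB z z' : dT (z - z') = dT z - dT z'.
  apply/ffunP => u; rewrite !ffunE -sumrB; apply: eq_bigr => d _.
  by rewrite !ffunE mulrBl.
have liftB z z' eps : lift (z - z') eps = lift z eps - lift z' eps.
  by rewrite -sumrB; apply: eq_bigr => d _; rewrite !ffunE mulrBl.
have baseP z : dT (z - base (dT z)) = 0.
  rewrite dTB /base; case: pickP => [z' /eqP->|/(_ z)]; rewrite ?subrr //.
  by rewrite eqxx.
pose key z := (dT z, t (z - base (dT z))).
pose Y (S : {set F}) : {ffun D -> 'F_2} := [ffun d => \sum_(c in S) (borders c d)%:R].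
have cycle_regions z z' : key z = key z' ->
    z - z' \in [set Y S | S in powerset regions].
  move=> [dz tz]; rewrite -dz in tz.
  have [s sP] := tP _ (baseP z).
  have [s' sP'] : exists s', forall eps, lift (z' - base (dT z)) eps =
      bdry2 l r s' eps + Lam (t (z' - base (dT z))) eps.
    by apply: tP; rewrite dz baseP.
  pose q f := s f - s' f.
  have qP eps : lift (z - z') eps = bdry2 l r q eps.
    have -> : z - z' = (z - base (dT z)) - (z' - base (dT z)).
      by rewrite opprB addrA subrK.
    rewrite liftB sP sP' tz /bdry2 /q opprD addrACA subrr addr0.
    by rewrite opprD addrACA.
  have q0 eps : ~~ inH eps -> bdry2 l r q eps = 0.
    move=> nH; rewrite -qP /lift big1 // => d _.
    have [PH _ _] := PP d; have [->|/PH] := eqVneq (P d eps) 0.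
      by rewrite mulr0.
    by rewrite (negPf nH).
  have qreg := constant_on_regions q0.
  apply/imsetP; exists [set f in regions | q f != 0].
    by rewrite powersetE; apply/subsetP => f; rewrite inE => /andP[].
  apply/ffunP => d; rewrite [RHS]ffunE.
  have -> : (z - z') d = bdry2 l r q (kappa d).
    rewrite -qP /lift (bigD1 d) //= big1 ?addr0 => [|d' dd'].
      by have [_ -> _] := PP d; rewrite eqxx mulr1.
    by have [_ -> _] := PP d'; rewrite (negPf dd') mulr0.
  transitivity (\sum_f q f * (borders f d)%:R).
    have pick1 f0 : \sum_f q f * (f0 == f)%:R = q f0.
      rewrite (bigD1 f0) //= eqxx mulr1 big1 ?addr0 // => f.
      by rewrite eq_sym => /negPf->; rewrite mulr0.
    rewrite /bdry2 qreg [q (r _)]qreg -2!pick1 -big_split /=.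
    apply: eq_bigr => f _; rewrite -mulrDr /borders; congr (_ * _).
    case: (region (l _) == f); case: (region (r _) == f);
      by rewrite /= ?addr0 ?add0r ?addF2xx.
  rewrite [RHS]big_mkcond /=; apply: eq_bigr => f _.
  rewrite !inE; have [->|/F2_neq0 qf] := eqVneq (q f) 0; first by rewrite mul0r andbF.
  rewrite qf mul1r andbT; case: (set0Pn _) => // nb.
  by case: (boolP (borders f d)) => // bfd; case: nb; exists d; rewrite inE.
have fiber y : (#|[set z | key z == y]| <= 2 ^ #|regions|)%N.
  have [->|/set0Pn[z0]] := eqVneq [set z | key z == y] set0; first by rewrite cards0.
  rewrite inE => /eqP key0; rewrite -card_powerset.
  apply: leq_trans (leq_imset_card Y _).
  rewrite -(card_imset _ (addIr (- z0))) subset_leq_card //.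
  apply/subsetP => x /imsetP[z zy ->]; move: zy; rewrite inE => /eqP keyz.
  by apply: cycle_regions; rewrite keyz.
have := card_le_fibers fiber; rewrite card_prod !card_F2fun card_ord -!expnD.
by rewrite leq_exp2l //; have := regions_le; lia.
Qed.

End BranchSets.

Lemma connect_closed (V : finType) (R : rel V) (A : {set V}) x y :
  (forall u w, u \in A -> R u w -> w \in A) -> x \in A -> connect R x y -> y \in A.
Proof.
move=> cl xA /connectP[p pth ->]; elim: p x xA pth => //= w p IHp x xA /andP[xw].
by apply: IHp; apply: cl xw.
Qed.

(** In place of branch sets and joining edges, the grid provides overlapping
    connected sets: A u around each vertex and M u v along each edge.  For an
    edge uv with u before v, the part of M u v outside A u that is connected to
    A v is added to A v; it must touch A u, since M u v is connected and meets
    it. *)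
Section Minor.
Context {V E F : finType} {a b : E -> V} {l r : E -> F} {ell : nat}.
Context {Lam : {ffun 'I_ell -> 'F_2} -> E -> 'F_2}.
Context (bdry_bdry : forall (s : F -> 'F_2) x, bdry1 a b (bdry2 l r s) x = 0).
Context (homology : forall z, (forall x, bdry1 a b z x = 0) ->
  exists (s : F -> 'F_2) t, forall eps, z eps = bdry2 l r s eps + Lam t eps).
Context {T : finType} {e : rel T} (es : symmetric e) (ei : irreflexive e).
Context {A : T -> {set V}} {M : T -> T -> {set V}}.
Context (A_n0 : forall u, A u != set0) (A_conn : forall u, conn a b (A u)).
Context (A_disj : forall u v x, x \in A u -> x \in A v -> u = v).
Context (M_conn : forall u v, e u v -> conn a b (M u v)).
Context (M_ends : forall u v, e u v ->
  (exists2 x, x \in M u v & x \in A u) /\ (exists2 x, x \in M u v & x \in A v)).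
Context (M_A : forall u v w x, e u v -> x \in M u v -> x \in A w -> w = u \/ w = v).
Context (M_M : forall u v u' v' x, e u v -> e u' v' -> x \in M u v -> x \in M u' v' ->
  (u' = u /\ v' = v) \/ (u' = v /\ v' = u)).

Let before (u v : T) := e u v && (enum_rank u < enum_rank v)%N.
Let W u v := M u v :\: A u.
Let relW u v x y := [&& adj a b x y, x \in W u v & y \in W u v].
Let piece u v := [set x in W u v |
  [exists y, (y \in A v :&: W u v) && connect (relW u v) y x]].
Let B v := [set x | (x \in A v) || [exists u, before u v && (x \in piece u v)]].

Let BE v x : (x \in B v) = (x \in A v) || [exists u, before u v && (x \in piece u v)].
Proof. exact: in_set. Qed.

Let AB v : A v \subset B v.
Proof. by apply/subsetP => x; rewrite inE => ->. Qed.

Let Bdisj u v x : x \in B u -> x \in B v -> u = v.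
Proof.
have piece_A u' v' w : before u' v' -> x \in piece u' v' -> x \in A w -> v' = w.
  case/andP=> euv _; rewrite !inE => /andP[/andP[xA xM] _] xw.
  by case: (M_A euv xM xw) => // wu; rewrite wu (negPf xA) in xw.
rewrite (BE u) (BE v) => /orP[xu|/existsP[u' /andP[uu' xu]]]
  /orP[xv|/existsP[v' /andP[vv' xv]]].
- exact: A_disj xu xv.
- by rewrite (piece_A _ _ _ vv' xv xu).
- exact: piece_A uu' xu xv.
- case/andP: uu' vv' => eu ru /andP[ev rv].
  move: xu xv; rewrite !inE => /andP[/andP[_ xu] _] /andP[/andP[_ xv] _].
  case: (M_M eu ev xu xv) => [[_ ->//]|[v'u vu']].
  by move: ru rv; rewrite v'u vu' => ru /(ltn_trans ru); rewrite ltnn.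
Qed.

Let relW_sym u v : symmetric (relW u v).
Proof. by move=> x y; rewrite /relW adj_sym [(x \in _) && _]andbC. Qed.

Let Bconn v : conn a b (B v).
Proof.
move=> C CB C0 Ccl.
have BC x : x \in C -> x \in B v by apply: (subsetP CB).
have piece_cl u x y : before u v -> x \in piece u v -> x \in C ->
    connect (relW u v) x y -> y \in C.
  move=> uv xp xC xy.
  suff : y \in C :&: piece u v by case/setIP.
  apply: connect_closed xy; last by rewrite inE xC.
  move=> p q /setIP[pC pp] pq.
  have qp : q \in piece u v.
    move: (pp) (pq); rewrite !inE => /andP[_ /existsP[z /andP[zA zp]]] /and3P[_ _ qW].
    rewrite !inE in qW; rewrite qW; apply/existsP; exists z; rewrite zA.
    exact: connect_trans zp (connect1 pq).
  rewrite inE qp andbT; apply: Ccl pC _ _; last by case/and3P: pq.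
  by rewrite inE; apply/orP; right; apply/existsP; exists u; rewrite uv.
have pieceP u x : x \in piece u v -> exists y, [/\ y \in A v, y \in piece u v &
    connect (relW u v) y x].
  rewrite inE => /andP[_ /existsP[y /andP[/setIP[yA yW] yx]]].
  exists y; split=> //; rewrite inE yW; apply/existsP; exists y.
  by rewrite inE yA yW connect0.
have CA : C :&: A v = A v.
  apply: A_conn; first exact: subsetIr.
    have [x xC] := set0Pn _ C0; apply/set0Pn.
    move: (BC x xC); rewrite inE => /orP[xA|/existsP[u /andP[uv xp]]].
      by exists x; rewrite inE xC.
    have [y [yA yp yx]] := pieceP u x xp; exists y; rewrite inE yA andbT.
    apply: (piece_cl u x y uv xp xC).
    by rewrite (sym_connect_sym (relW_sym u v)).
  move=> x y /setIP[xC xA] yA xy; rewrite inE yA andbT.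
  by apply: Ccl xC _ xy; apply: (subsetP (AB v)).
have AC x : x \in A v -> x \in C by rewrite -CA => /setIP[].
apply/eqP; rewrite eqEsubset CB /=; apply/subsetP => x.
rewrite inE => /orP[/AC//|/existsP[u /andP[uv xp]]].
have [y [yA yp yx]] := pieceP u x xp.
exact: piece_cl uv yp (AC y yA) yx.
Qed.

(** Were the piece not adjacent to A u, it would be closed in M u v, hence all
    of M u v, although it avoids A u. *)
Let crossing u v : before u v -> exists eps,
  (a eps \in B u) && (b eps \in B v) || (a eps \in B v) && (b eps \in B u).
Proof.
move=> uv; have /andP[euv _] := uv.
have pB x : x \in piece u v -> x \in B v.
  by move=> xp; rewrite inE; apply/orP; right; apply/existsP; exists u; rewrite uv.
suff [x [y [xp yA xy]]] : exists x y, [/\ x \in piece u v, y \in A u & adj a b x y].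
  have xB := pB x xp; have yB := subsetP (AB u) y yA.
  case/existsP: xy => eps eP; exists eps.
  case/orP: eP => /andP[/eqP ae /eqP be]; apply/orP; [right|left].
    by apply/andP; split; [rewrite ae|rewrite be].
  by apply/andP; split; [rewrite ae|rewrite be].
have [[xu xuM xuA] [xv xvM xvA]] := M_ends euv.
have uNv : u != v by apply: contraTneq euv => ->; rewrite ei.
suff /exists_inP[x xp /exists_inP[y yA xy]] :
  [exists x in piece u v, [exists y in A u, adj a b x y]] by exists x, y.
apply: contraT => no; exfalso.
have pM : piece u v = M u v.
  apply: (M_conn euv).
  - by apply/subsetP => x; rewrite !inE => /andP[/andP[_ ->]].
  - apply/set0Pn; exists xv; have xvW : xv \in W u v.
      by rewrite inE xvM andbT; apply: contra uNv => /A_disj/(_ xvA)->.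
    rewrite inE xvW; apply/existsP; exists xv.
    by rewrite inE xvA xvW connect0.
  - move=> x y xp yM xy.
    have yW : y \in W u v.
      rewrite inE yM andbT; apply: contra no => yA.
      by apply/exists_inP; exists x => //; apply/exists_inP; exists y.
    move: (xp); rewrite inE => /andP[xW /existsP[z /andP[zA zx]]].
    rewrite inE yW; apply/existsP; exists z; rewrite zA.
    by apply: connect_trans zx (connect1 _); rewrite /relW xy xW yW.
by move: xuM; rewrite -pM !inE xuA.
Qed.

Lemma minor_edge_bound : (\sum_u #|[set v | e u v]| <= 6 * (#|T| + ell))%N.
Proof.
pose D := {p : T * T | before p.1 p.2}.
have [kappa kappaP] := fin_all_exists (fun d : D => crossing (valP d)).
have loopless (d : D) : (val d).1 != (val d).2.
  by apply: contraTneq (valP d) => ->; rewrite /before ei.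
have simple (d d' : D) : ((val d).1 == (val d').1) && ((val d).2 == (val d').2) ||
    ((val d).1 == (val d').2) && ((val d).2 == (val d').1) -> d = d'.
  move=> dd; apply: val_inj; move: dd (valP d) (valP d').
  case: (val d) (val d') => [u v] [u' v'] /= /orP[] /andP[/eqP-> /eqP->] //.
  by move=> /andP[_ lt] /andP[_ /(ltn_trans lt)]; rewrite ltnn.
have B_n0 u : B u != set0.
  by have /set0Pn[x xA] := A_n0 u; apply/set0Pn; exists x; apply: (subsetP (AB u)).
have := branch_sets_edge_bound bdry_bdry homology loopless simple Bdisj Bconn B_n0 kappaP.
have degE : (\sum_u #|[set v | e u v]|)%N = (#|{: D}| + #|{: D}|)%N.
  have cardD : #|{: D}| = (\sum_u \sum_v before u v)%N.
    rewrite card_sig -sum1_card big_mkcond pair_big /=.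
    by apply: eq_big => // -[u v] _; rewrite inE /=; case: before.
  rewrite {2}cardD exchange_big cardD -big_split /=; apply: eq_bigr => u _.
  rewrite -big_split /= -sum1_card big_mkcond; apply: eq_bigr => v _ /=.
  rewrite inE /before [e v u]es; case euv: (e u v) => //=.
  case: ltngtP => // /ord_inj/enum_rank_inj uv.
  by rewrite uv ei in euv.
by move=> bound; rewrite degE; apply: leq_trans (leq_add bound bound) _; lia.
Qed.

End Minor.

(** * The polar grid on a polygon with paired sides *)

Lemma F2_cancel3 (p q r : 'F_2) : q + (p + r) + (p + q) + r = 0.
Proof.
by case: p q r => [[|[|//]] ?] [[|[|//]] ?] [[|[|//]] ?]; apply: val_inj.
Qed.

(** Each of the n sides of the polygon is divided into L parts; this gives n L
    spots around the polygon, in the cyclic order [nxt].  The radius is divided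
    into N parts.  Side k carries [letter k], traversed in the direction
    [sgn k], and the letter c appears exactly on the sides [occ1 c] and
    [occ2 c].  The map [cc] sends a corner of the polygon to a representative
    of its class under the gluing. *)
Section PolarGrid.
Context {n ell L' N1 : nat}.
Notation L := L'.+1.
Notation N := N1.+1.
Context {letter : 'I_n -> 'I_ell} {sgn : 'I_n -> bool} {occ1 occ2 : 'I_ell -> 'I_n}.
Context (occP : forall k c, (letter k == c) = (k == occ1 c) || (k == occ2 c)).
Context (occN : forall c, occ1 c != occ2 c).
Context {cc : 'I_n -> 'I_n}.

Definition cstart k := if sgn k then k else ordS k.
Definition cend k := if sgn k then ordS k else k.
Context (cc_glued : forall k k', letter k = letter k' ->
  cc (cstart k) = cc (cstart k') /\ cc (cend k) = cc (cend k')).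

Lemma letter_occ1 c : letter (occ1 c) = c.
Proof. by apply/eqP; rewrite occP eqxx. Qed.

Lemma letter_occ2 c : letter (occ2 c) = c.
Proof. by apply/eqP; rewrite occP eqxx orbT. Qed.

Definition spot : finType := ('I_n * 'I_L)%type.
(** The next spot counterclockwise, passing to the next side after the last
    part of a side. *)
Definition nxt (j : spot) : spot :=
  if (j.2.+1 < L)%N then (j.1, inord j.2.+1) else (ordS j.1, ord0).
(** Part c of side k, counted in the direction of its letter: what the gluing
    preserves. *)
Definition along k (c : 'I_L) : spot := (k, if sgn k then c else rev_ord c).

(** The vertices are the centre, the points inside the disc, the points inside
    the sides (indexed from 1, and shared by the two sides of a letter), and the corners; the edges are the
    radial ones, the concentric ones inside the disc, and those on the
    letters. *)
Definition gvertex : finType := (unit + ('I_N1 * spot) + ('I_ell * 'I_L) + 'I_n)%type.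
Definition gedge : finType := (('I_N * spot) + ('I_N1 * spot) + ('I_ell * 'I_L))%type.
Definition gface : finType := ('I_N * spot)%type.

Definition hub : gvertex := inl (inl (inl tt)).
Definition inner i j : gvertex := inl (inl (inr (i, j))).
Definition side c t : gvertex := inl (inr (c, t)).
Definition corner k : gvertex := inr (cc k).

(** The vertex at the start of a spot of the boundary. *)
Definition bv (j : spot) : gvertex :=
  if j.2 == ord0 then corner j.1
  else side (letter j.1) (if sgn j.1 then j.2 else inord (L - j.2)).

Definition vtx (i : nat) (j : spot) : gvertex :=
  if i is i'.+1 then (if insub i' is Some i0 then inner i0 j else bv j)
  else hub.

Definition ea (x : gedge) : gvertex := match x with
  | inl (inl (i, j)) => vtx i (nxt j)
  | inl (inr (i, j)) => vtx i.+1 j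
  | inr (c, t) => bv (along (occ1 c) t)
  end.
Definition eb (x : gedge) : gvertex := match x with
  | inl (inl (i, j)) => vtx i.+1 (nxt j)
  | inl (inr (i, j)) => vtx i.+1 (nxt j)
  | inr (c, t) => bv (nxt (along (occ1 c) t))
  end.
Definition fl (x : gedge) : gface := match x with
  | inl (inl (i, j)) => (i, j)
  | inl (inr (i, j)) => (widen_ord (leqnSn _) i, j)
  | inr (c, t) => (ord_max, along (occ1 c) t)
  end.
Definition fr (x : gedge) : gface := match x with
  | inl (inl (i, j)) => (i, nxt j)
  | inl (inr (i, j)) => (lift ord0 i, j)
  | inr (c, t) => (ord_max, along (occ2 c) t)
  end.

Lemma vtx_inner (i : 'I_N1) j : vtx i.+1 j = inner i j.
Proof. by rewrite /vtx valK. Qed.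

Lemma vtx_bv j : vtx N j = bv j.
Proof. by rewrite /vtx insubF // ltnn. Qed.

Lemma ordS_inj m : injective (@ordS m).
Proof. exact: can_inj (@ordSK m). Qed.

Lemma nxt_inj : injective nxt.
Proof.
move=> [k c] [k' c']; rewrite /nxt /=.
case: ltnP => cL; case: ltnP => cL' [].
- by move=> -> /(congr1 val) /=; rewrite !inordK // => -[/val_inj->].
- by move=> _ /(congr1 val) /=; rewrite !inordK.
- by move=> _ /(congr1 val) /=; rewrite !inordK.
- move=> h; have -> : k = k' by apply: ordS_inj; apply: val_inj.
  congr (_, _); apply: val_inj => /=.
  by have := ltn_ord c; have := ltn_ord c'; lia.
Qed.

(** Vertex number t, for t at most L, of side k in the direction of its
    letter. *)
Definition letter_vtx k t : gvertex :=
  if t == 0%N then corner (cstart k) else if (t < L)%N then side (letter k) (inord t)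
  else corner (cend k).

Lemma letter_vtx_glued k k' t : letter k = letter k' -> letter_vtx k t = letter_vtx k' t.
Proof.
move=> kk'; have [cs ce] := cc_glued kk'.
by rewrite /letter_vtx /corner cs ce kk'.
Qed.

Lemma along_ends k (c : 'I_L) :
  (bv (along k c), bv (nxt (along k c))) =
  if sgn k then (letter_vtx k c, letter_vtx k c.+1)
  else (letter_vtx k c.+1, letter_vtx k c).
Proof.
rewrite /along /nxt /bv /letter_vtx /corner /cstart /cend /=.
have cL := ltn_ord c; case sk: (sgn k) => /=.
  congr (_, _).
    by rewrite -val_eqE /= cL inord_val; case: eqP.
  case: ltnP => c1L /=; last by [].
  by rewrite -val_eqE /= inordK //= sk.
congr (_, _); last first.
  case: ltnP => c1L /=.
    have c0 : (nat_of_ord c == 0)%N = false by lia.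
    rewrite -val_eqE /= inordK // sk c0 cL.
    by congr side; congr inord; lia.
  by have -> : (nat_of_ord c == 0)%N by lia.
rewrite -val_eqE /=; case: ltnP => c1L.
  have -> : (L - c.+1 == 0)%N = false by lia.
  by congr side; congr inord; lia.
by have -> : (L - c.+1 == 0)%N by lia.
Qed.

Definition gdelta x i j : 'F_2 := (vtx i j == x)%:R.
Definition gwall x i j : 'F_2 := gdelta x i j + gdelta x i (nxt j).

Lemma gwall_along x k k' c : letter k = letter k' ->
  gwall x N (along k c) = gwall x N (along k' c).
Proof.
move=> kk'; rewrite /gwall /gdelta !vtx_bv; have := along_ends k c; have := along_ends k' c.
rewrite !(letter_vtx_glued _ kk').
by case: (sgn k); case: (sgn k') => -[-> ->] [-> ->] //; rewrite addrC.
Qed.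

Lemma sum_spots (f : spot -> 'F_2) :
  \sum_j f j = \sum_c \sum_t (f (along (occ1 c) t) + f (along (occ2 c) t)).
Proof.
have sideE k : \sum_t f (k, t) = \sum_t f (along k t).
  rewrite /along; case: (sgn k) => //.
  by rewrite (reindex_inj rev_ord_inj).
transitivity (\sum_k \sum_t f (along k t)).
  rewrite -(eq_bigr _ (fun k _ => sideE k)) pair_big /=.
  by apply: eq_bigr => -[].
rewrite (partition_big letter predT) //=; apply: eq_bigr => c _.
rewrite (bigD1 (occ1 c)) ?occP ?eqxx //= (bigD1 (occ2 c)) /=; last first.
  by rewrite occP eqxx orbT eq_sym occN.
rewrite [X in _ + (_ + X)]big1 ?addr0 ?big_split // => k; rewrite occP.
by case: (k == occ1 c); case: (k == occ2 c).
Qed.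

Lemma big_edges (f : gedge -> 'F_2) : \sum_x f x =
  \sum_i \sum_j f (inl (inl (i, j))) + \sum_i \sum_j f (inl (inr (i, j))) +
  \sum_c \sum_t f (inr (c, t)).
Proof.
rewrite !big_sumType /= !pair_big /=.
by congr (_ + _ + _); apply: eq_bigr => -[].
Qed.

(** The boundary of a cell consists of two walls, of index i and i + 1, and of
    two radii.  Radii cancel by rotation, walls inside the disc cancel between
    consecutive rings, and the walls on the sides cancel in pairs because each
    letter occurs twice. *)
Lemma polar_bdry_bdry (s : gface -> 'F_2) x : bdry1 ea eb (bdry2 fl fr s) x = 0.
Proof.
rewrite /bdry1 big_edges.
pose S i j := s (inord i, j) * gwall x i j; pose S' i j := s (inord i, j) * gwall x i.+1 j.
have rad : \sum_(i < N) \sum_j bdry2 fl fr s (inl (inl (i, j))) * inc ea eb (inl (inl (i, j))) x =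
    \sum_(i < N) \sum_j S i j + \sum_(i < N) \sum_j S' i j.
  rewrite -big_split; apply: eq_bigr => i _ /=; rewrite -big_split /=.
  rewrite /bdry2 /inc /= -/(gdelta x _ _).
  under eq_bigr do rewrite mulrDl.
  rewrite big_split /=.
  have shift h : \sum_j h (nxt j) = \sum_j h j :> 'F_2 by rewrite [RHS](reindex_inj nxt_inj).
  rewrite (shift (fun j => s (i, j) * (gdelta x i j + gdelta x i.+1 j))).
  rewrite -big_split; apply: eq_bigr => j _ /=.
  rewrite /S /S' inord_val -!mulrDr /gwall; congr (_ * _).
  by rewrite addrC addrACA.
have cir : \sum_(i < N1) \sum_j bdry2 fl fr s (inl (inr (i, j))) * inc ea eb (inl (inr (i, j))) x =
    \sum_(i < N1) \sum_j S' i j + \sum_(i < N1) \sum_j S i.+1 j.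
  rewrite -big_split; apply: eq_bigr => i _ /=; rewrite -big_split /=.
  apply: eq_bigr => j _; rewrite /bdry2 /inc /= -/(gdelta x _ _) /S /S' -/(gwall x _ _) -mulrDl.
  have iN := ltn_ord i.
  by congr ((s (_, _) + s (_, _)) * _); apply: val_inj; rewrite /= inordK //; lia.
have bd : \sum_c \sum_t bdry2 fl fr s (inr (c, t)) * inc ea eb (inr (c, t)) x =
    \sum_j S' N1 j.
  rewrite sum_spots; apply: eq_bigr => c _; apply: eq_bigr => t _.
  have o12 : letter (occ1 c) = letter (occ2 c).
    by rewrite letter_occ1 letter_occ2.
  rewrite /S' -(gwall_along _ _ o12) -mulrDl /bdry2 /inc /gwall /gdelta !vtx_bv /=.
  by congr ((s (_, _) + s (_, _)) * _); apply: val_inj; rewrite /= inordK.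
apply: etrans (f_equal2 +%R (f_equal2 +%R rad cir) bd) _.
rewrite big_ord_recl [X in _ + X + _ + _]big_ord_recr /=.
rewrite [X in X + _ + _ + _ + _]big1 ?add0r => [|j _]; last by rewrite /S /gwall addF2xx mulr0.
exact: F2_cancel3.
Qed.

Lemma pick_sum2 (A B : finType) (f : A -> B -> 'F_2) a0 b0 :
  \sum_a \sum_b f a b * ((a == a0) && (b == b0))%:R = f a0 b0.
Proof.
rewrite (bigD1 a0) //= (bigD1 b0) //= !eqxx mulr1.
rewrite [X in _ + X + _]big1 ?addr0 => [|b /negPf->]; last by rewrite andbF mulr0.
rewrite big1 ?addr0 // => a /negPf->; rewrite big1 // => b _.
by rewrite mulr0.
Qed.

Lemma bv_hub j : (bv j == hub) = false.
Proof. by rewrite /bv; case: ifP. Qed.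

Lemma bv_inner j i0 j0 : (bv j == inner i0 j0) = false.
Proof. by rewrite /bv; case: ifP. Qed.

Lemma vtx_hub i j : (vtx i j == hub) = (i == 0%N).
Proof.
case: i => [|i]; first by rewrite eqxx.
rewrite /vtx; case: insub => [i0|] //; rewrite /bv; by case: ifP.
Qed.

Lemma vtx_eq_inner i j i0 j0 : (vtx i j == inner i0 j0) = (i == i0.+1) && (j == j0).
Proof.
case: i => [|i] //; rewrite eqSS /vtx; case: insubP => [i1 _ /= <-|].
  apply/eqP/andP => [[-> ->]|[/eqP/val_inj-> /eqP->]] //; by rewrite !eqxx.
move=> iN; have -> : (i == i0 :> nat) = false.
  by apply: contraNF iN => /eqP->; apply: ltn_ord.
by rewrite /bv; case: ifP.
Qed.

Lemma letter_vtx_eq_side k t c (t0 : 'I_L) : t0 != ord0 -> (t <= L)%N ->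
  (letter_vtx k t == side c t0) = (letter k == c) && (t == t0).
Proof.
move=> t00 tL; rewrite /letter_vtx; case: (eqVneq t 0%N) => [->|t0'].
  by rewrite [0%N == _]eq_sym -[0%N]/(val (@ord0 L')) val_eqE (negPf t00) andbF.
case: ltnP => tL'; last first.
  have -> : t == t0 = false by apply: contraTF tL' => /eqP->; rewrite -ltnNge.
  by rewrite andbF.
apply/eqP/andP => [[-> <-]|[/eqP-> /eqP->]]; last by rewrite inord_val.
by rewrite inordK.
Qed.

Section Cycles.
Context {z : gedge -> 'F_2} (zcycle : forall x, bdry1 ea eb z x = 0).

Lemma cycle_hub : \sum_j z (inl (inl (ord0, j))) = 0.
Proof.
rewrite -[RHS](zcycle hub) /bdry1 big_edges.
rewrite [X in _ = _ + X]big1 ?addr0 => [|c _]; last first.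
  by rewrite big1 // => t _; rewrite /inc /ea /eb !bv_hub addr0 mulr0.
rewrite [X in _ = _ + X]big1 ?addr0 => [|i _]; last first.
  by rewrite big1 // => j _; rewrite /inc /ea /eb !vtx_hub addr0 mulr0.
rewrite big_ord_recl [X in _ = _ + X]big1 ?addr0 => [|i _]; last first.
  by rewrite big1 // => j _; rewrite /inc /ea /eb !vtx_hub addr0 mulr0.
by apply: eq_bigr => j _; rewrite /inc /ea /eb !vtx_hub addr0 mulr1.
Qed.

Lemma cycle_inner (i : 'I_N1) j :
  z (inl (inl (widen_ord (leqnSn _) i, j))) + z (inl (inl (lift ord0 i, j))) =
  z (inl (inr (i, j))) + z (inl (inr (i, nxt j))).
Proof.
apply: F2_addr_eq0; rewrite -[RHS](zcycle (inner i (nxt j))) /bdry1 big_edges.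
rewrite [X in _ = _ + X]big1 ?addr0 => [|c _]; last first.
  by rewrite big1 // => t _; rewrite /inc /ea /eb !bv_inner addr0 mulr0.
congr (_ + _).
  rewrite addrC -(pick_sum2 (fun i j => z (inl (inl (i, j)))) (lift ord0 i) j).
  rewrite -(pick_sum2 (fun i j => z (inl (inl (i, j)))) (widen_ord (leqnSn _) i) j).
  rewrite -big_split; apply: eq_bigr => i' _; rewrite -big_split; apply: eq_bigr => j' _ /=.
  rewrite -mulrDr /inc /ea /eb !vtx_eq_inner (inj_eq nxt_inj) -!val_eqE /= eqSS.
  by rewrite /bump /= add1n.
rewrite addrC -(pick_sum2 (fun i j => z (inl (inr (i, j)))) i (nxt j)).
rewrite -(pick_sum2 (fun i j => z (inl (inr (i, j)))) i j).
rewrite -big_split; apply: eq_bigr => i' _; rewrite -big_split; apply: eq_bigr => j' _ /=.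
by rewrite -mulrDr /inc /ea /eb !vtx_eq_inner (inj_eq nxt_inj) eqSS.
Qed.

Lemma cycle_side c (t t' : 'I_L) : t' = t.+1 :> nat ->
  (forall i j, z (inl (inl (i, j))) = 0) -> (forall i j, z (inl (inr (i, j))) = 0) ->
  z (inr (c, t)) = z (inr (c, t')).
Proof.
move=> tt' zR zC; apply: F2_addr_eq0.
have t'0 : t' != ord0 by rewrite -val_eqE /= tt'.
rewrite -[RHS](zcycle (side c t')) /bdry1 big_edges.
rewrite [X in _ = X + _ + _]big1 ?add0r => [|i _]; last first.
  by rewrite big1 // => j _; rewrite zR mul0r.
rewrite [X in _ = X + _]big1 ?add0r => [|i _]; last first.
  by rewrite big1 // => j _; rewrite zC mul0r.
rewrite -(pick_sum2 (fun c t => z (inr (c, t))) c t).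
rewrite -(pick_sum2 (fun c t => z (inr (c, t))) c t').
rewrite -big_split; apply: eq_bigr => c' _; rewrite -big_split; apply: eq_bigr => s _ /=.
rewrite -mulrDr /inc /=; congr (_ * _).
have := along_ends (occ1 c') s.
have e1 : (letter_vtx (occ1 c') s == side c t') = (c' == c) && (s == t').
  by rewrite letter_vtx_eq_side ?letter_occ1 // ltnW // ltn_ord.
have e2 : (letter_vtx (occ1 c') s.+1 == side c t') = (c' == c) && (s == t).
  by rewrite letter_vtx_eq_side ?letter_occ1 ?ltn_ord // tt' eqSS.
by case: (sgn _) => -[-> ->]; rewrite e1 e2 // addrC.
Qed.

End Cycles.

(** Combinations of the closed curves run through by whole letters. *)
Definition gloops (t : {ffun 'I_ell -> 'F_2}) (x : gedge) : 'F_2 :=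
  if x is inr (c, _) then t c else 0.

Definition rank_spot (j : spot) : nat := (j.1 * L + j.2)%N.

Lemma rank_spot_inj : injective rank_spot.
Proof.
move=> [k c] [k' c'] /=; rewrite /rank_spot /= => eq_rk.
have cL := ltn_ord c; have cL' := ltn_ord c'.
have kk : k = k'.
  apply: val_inj => /=; have := congr1 (divn^~ L) eq_rk.
  by rewrite !divnMDl // !divn_small // !addn0.
by congr (_, _) => //; apply: val_inj; move: eq_rk; rewrite kk => /addnI.
Qed.

Lemma rank_spot_nxt j : (0 < rank_spot (nxt j))%N -> rank_spot (nxt j) = (rank_spot j).+1.
Proof.
case: j => k c; rewrite /nxt [(k, c).2]/= [(k, c).1]/=.
have cL := ltn_ord c; have kn := ltn_ord k.
case: (ltnP c.+1 L) => c1; rewrite /rank_spot /=; first by rewrite inordK // addnS.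
have [kl|kl] := eqVneq k.+1 n; first by rewrite kl modnn.
by rewrite modn_small; [move=> _; rewrite mulSn; lia | lia].
Qed.

Lemma rank_spot_last j j' : rank_spot (nxt j) = 0%N -> (rank_spot j' <= rank_spot j)%N.
Proof.
case: j j' => [k c] [k' c']; rewrite /nxt [(k, c).2]/= [(k, c).1]/=.
have [[cL cL'] [kn kn']] := ((ltn_ord c, ltn_ord c'), (ltn_ord k, ltn_ord k')).
case: (ltnP c.+1 L) => c1; rewrite /rank_spot /=.
  by rewrite inordK // addnS.
have [kl _|kl] := eqVneq k.+1 n; last by rewrite modn_small; lia.
have : (k' * L <= k * L)%N by rewrite leq_mul2r; apply/orP; right; lia.
have : c = L' :> nat by lia.
move: cL'; lia.
Qed.

(** A cycle is killed edge by edge.  Summing the innermost radial edges from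
    spot 0 on, and then the concentric edges outwards, defines cell
    coefficients whose boundary agrees with z on all edges inside the disc:
    on the innermost radii because the sum around the centre vanishes, further
    out by the cycle condition at inner vertices.  What remains is a cycle on
    the letters, constant along each of them. *)
Lemma polar_homology z : (forall x, bdry1 ea eb z x = 0) ->
  exists (s : gface -> 'F_2) t, forall x, z x = bdry2 fl fr s x + gloops t x.
Proof.
move=> zcycle.
(* The sum of the innermost radial edges met going round from spot 0 to j. *)
pose s0 j := \sum_(j' | (rank_spot j' < rank_spot j)%N) z (inl (inl (ord0, j'))).
pose s (f : gface) : 'F_2 :=
  s0 f.2 + \sum_(i' < N1 | (i' < f.1)%N) z (inl (inr (i', f.2))).
have sC i j : bdry2 fl fr s (inl (inr (i, j))) = z (inl (inr (i, j))).
  rewrite /bdry2 /s /= /bump /=.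
  rewrite addrACA addF2xx add0r [X in _ + X](bigD1 i) /=; last by rewrite add1n.
  rewrite addrCA -[RHS]addr0; congr (_ + _); apply: etrans (addF2xx (\sum_(i' < N1 | (i' < i)%N) z (inl (inr (i', j))))).
  congr (_ + _); apply: eq_bigl => i'.
  by rewrite add1n ltnS -val_eqE /=; case: ltngtP.
have s0R j : s0 j + s0 (nxt j) = z (inl (inl (ord0, j))).
  have [nxt0|nxt_gt0] := posnP (rank_spot (nxt j)).
    have -> : s0 (nxt j) = 0 by rewrite /s0 nxt0 big1.
    rewrite addr0; apply: F2_addr_eq0; rewrite -[RHS](cycle_hub zcycle).
    rewrite [RHS](bigD1 j) //= addrC; congr (_ + _); apply: eq_bigl => j'.
    by rewrite ltn_neqAle (rank_spot_last _ nxt0) andbT (inj_eq rank_spot_inj).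
  rewrite {2}/s0 (bigD1 j) /=; last by rewrite rank_spot_nxt.
  rewrite addrCA -[RHS]addr0; congr (_ + _); apply: etrans (addF2xx (s0 j)).
  congr (_ + _); apply: eq_bigl => j'.
  rewrite rank_spot_nxt // ltnS -(inj_eq rank_spot_inj).
  by case: ltngtP.
have sR (i : 'I_N) j : bdry2 fl fr s (inl (inl (i, j))) = z (inl (inl (i, j))).
  case: i => i iN; elim: i iN => [|i IHi] iN.
    rewrite /bdry2 /s /= !big_pred0 // !addr0 s0R.
    by congr (z (inl (inl (_, _)))); apply: val_inj.
  have iN1 : (i < N1)%N by [].
  have wi : widen_ord (leqnSn N1) (Ordinal iN1) = Ordinal (ltnW iN) by apply: val_inj.
  have li : lift ord0 (Ordinal iN1) = Ordinal iN by apply: val_inj.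
  have := cycle_inner (polar_bdry_bdry s) (Ordinal iN1) j.
  have := cycle_inner zcycle (Ordinal iN1) j.
  by rewrite wi li !sC IHi => <- /addrI.
pose z' x := z x + bdry2 fl fr s x.
have z'cycle x : bdry1 ea eb z' x = 0 by rewrite bdry1D zcycle polar_bdry_bdry addr0.
have zR i j : z' (inl (inl (i, j))) = 0 by rewrite /z' sR addF2xx.
have zC i j : z' (inl (inr (i, j))) = 0 by rewrite /z' sC addF2xx.
exists s, [ffun c => z' (inr (c, ord0))].
have zB c t : z' (inr (c, t)) = z' (inr (c, ord0)).
  case: t => t tL; elim: t tL => [|t IHt] tL; first by congr (z' (inr (_, _))); apply: val_inj.
  by rewrite -(IHt (ltnW tL)); apply/esym/cycle_side.
move=> [[[i j]|[i j]]|[c t]] /=; rewrite ?addr0 ?sR ?sC //.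
by rewrite ffunE -(zB c t) /z' addrC -addrA addF2xx addr0.
Qed.

End PolarGrid.

(** * The boundary circle and the gluing relation *)

From mathcomp Require Import all_classical all_reals all_analysis.
Import numFieldNormedType.Exports.
Local Open Scope classical_set_scope.
Local Open Scope ring_scope.

Section Circle.
Context {R : realType}.
Implicit Types s t c x y : R.

Lemma cos_eq1 t : 0 <= t < pi *+ 2 -> cos t = 1 -> t = 0.
Proof.
move=> /andP[t0 t2] ct; have pi0 := @pi_ge0 R.
have [tpi|tpi] := leP t pi.
  by apply: cos_inj; rewrite ?in_itv /= ?t0 ?lexx ?pi0 // ct cos0.
have : pi *+ 2 - t = 0.
  apply: cos_inj; rewrite ?in_itv /= ?lexx ?pi0 //; first by apply/andP; split; lra.
  by rewrite cos0 -ct -[LHS]cosN opprB -(cosD2pi (t - _)) subrK.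
lra.
Qed.

Lemma angle_inj s t : 0 <= s < pi *+ 2 -> 0 <= t < pi *+ 2 ->
  cos s = cos t -> sin s = sin t -> s = t.
Proof.
wlog ts : s t / t <= s.
  by move=> h s0 t0 cst sst; case: (leP t s) => [/h->//|/ltW/h->].
move=> /andP[s0 s2] /andP[t0 t2] cst sst.
suff : s - t = 0 by lra.
apply: cos_eq1; first by apply/andP; split; lra.
by rewrite cosB cst sst -!expr2 cos2Dsin2.
Qed.

Lemma angle_surj c s : c ^+ 2 + s ^+ 2 = 1 ->
  exists t, [/\ 0 <= t < pi *+ 2, cos t = c & sin t = s].
Proof.
move=> cs; have pi0 := @pi_gt0 R.
have c1 : -1 <= c <= 1.
  by rewrite -ler_norml -(@expr_le1 _ 2) // real_normK ?num_real // -cs lerDl sqr_ge0.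
have ca : cos (acos c) = c by rewrite acosK // in_itv.
have sa : sin (acos c) = `|s|.
  by rewrite sin_acos // -cs addrC addKr sqrtr_sqr.
have a0 := acos_ge0 c1; have api := acos_lepi c1.
have [s0|s0] := leP 0 s.
  exists (acos c); rewrite ca sa ger0_norm // a0; split=> //.
  by apply: le_lt_trans api _; lra.
exists (pi *+ 2 - acos c); split.
- have : acos c != 0.
    by apply: contraTneq s0 => ac; move: sa; rewrite ac sin0 => /esym/normr0_eq0->; rewrite ltxx.
  by rewrite neq_lt ltNge a0 /= => ac; apply/andP; split; lra.
- by rewrite -cosN opprB -(cosD2pi (_ - _)) subrK.
- by rewrite -[LHS]opprK -sinN opprB -(sinD2pi (_ - _)) subrK sa ltr0_norm // opprK.
Qed.

Context {n : nat} (n0 : (0 < n)%N).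
Notation pb := (@polygon_boundary R n).

Let nR : 0 < n%:R :> R. Proof. by rewrite ltr0n. Qed.

Let angle_bounds x : 0 <= x < n%:R -> 0 <= 2 * pi * x / n%:R < pi *+ 2.
Proof.
move=> /andP[x0 xn]; have pi0 := @pi_gt0 R.
have pi2 : 0 < 2 * pi :> R by rewrite mulr_gt0.
apply/andP; split; first by apply: divr_ge0; [apply: mulr_ge0 => //|]; apply: ltW.
by rewrite ltr_pdivrMr // -(mulr_natl pi 2) ltr_pM2l.
Qed.

Lemma polygon_boundary_period x : pb (x + n%:R) = pb x.
Proof.
rewrite /polygon_boundary.
have -> : 2 * pi * (x + n%:R) / n%:R = 2 * pi * x / n%:R + pi *+ 2.
  by field; rewrite gt_eqF.
by rewrite cosD2pi sinD2pi.
Qed.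

Lemma polygon_boundary_inj x y : 0 <= x < n%:R -> 0 <= y < n%:R -> pb x = pb y -> x = y.
Proof.
move=> xn yn [cxy sxy].
have := angle_inj (angle_bounds xn) (angle_bounds yn) cxy sxy.
have pi0 := @pi_gt0 R.
move=> /(congr1 (fun z => z * n%:R)); rewrite !divfK ?gt_eqF //.
by apply: mulfI; rewrite gt_eqF // mulr_gt0.
Qed.

Lemma polygon_boundary_eq x y : 0 <= x <= n%:R -> 0 <= y <= n%:R -> pb x = pb y ->
  x = y \/ (x = 0 \/ x = n%:R) /\ (y = 0 \/ y = n%:R).
Proof.
have pbn : pb n%:R = pb 0 by rewrite -[n%:R]add0r polygon_boundary_period.
move=> /andP[x0]; rewrite le_eqVlt => /orP[/eqP->|xn] /andP[y0];
  rewrite le_eqVlt => /orP[/eqP->|yn].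
- by left.
- rewrite pbn => /polygon_boundary_inj -> //; last by rewrite y0.
    by right; split; [right|left].
  by rewrite lexx.
- rewrite pbn => /polygon_boundary_inj -> //; last by rewrite lexx.
    by right; split; [left|right].
  by rewrite x0.
- by move=> /polygon_boundary_inj->; rewrite ?x0 ?y0 //; left.
Qed.

Lemma polygon_boundary_surj c s : c ^+ 2 + s ^+ 2 = 1 ->
  exists2 x, 0 <= x < n%:R & pb x = (c, s).
Proof.
move=> /angle_surj[t [/andP[t0 t2] ct st]]; have pi0 := @pi_gt0 R.
have pi2 : 0 < 2 * pi :> R by rewrite mulr_gt0.
exists (t * n%:R / (2 * pi)).
  apply/andP; split; first by apply: divr_ge0; [apply: mulr_ge0 => //|]; apply: ltW.
  by rewrite ltr_pdivrMr // mulrC ltr_pM2l // mulr_natl.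
rewrite /polygon_boundary -ct -st.
have -> : 2 * pi * (t * n%:R / (2 * pi)) / n%:R = t.
  by rewrite [2 * pi * _]mulrC divfK ?mulfK // gt_eqF.
by [].
Qed.

Lemma polygon_boundary_circle x : (pb x).1 ^+ 2 + (pb x).2 ^+ 2 = 1.
Proof. exact: cos2Dsin2. Qed.

Lemma polygon_boundary_continuous : continuous pb.
Proof.
have angle_cont : continuous (fun y : R => 2 * pi * y / n%:R).
  by move=> y; apply: cvgM (cvgM (cvg_cst _) cvg_id) (cvg_cst _).
move=> x.
have cosc := continuous_comp (angle_cont x) (@continuous_cos R _).
have sinc := continuous_comp (angle_cont x) (@continuous_sin R _).
exact: cvg_pair cosc sinc.
Qed.

End Circle.

(** When each letter occurs at most twice, the equivalence generated by the
    gluing has a simple form away from the corners: one gluing step.  The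
    corners, whose classes may be long, are lumped together, which loses nothing
    that matters: corners are always vertices of the grid. *)
Section Gluing.
Context {R : realType} {w : word}.
Notation n := (size w).
Notation pb := (@polygon_boundary R n).
Notation letterN k := (nth (0, true)%N w k).1.
Notation signN k := (nth (0, true)%N w k).2.
Context (n0 : (0 < n)%N).
Context (pairing : forall i j m, (i < n)%N -> (j < n)%N -> (m < n)%N ->
  letterN i = letterN j -> letterN j = letterN m -> [\/ i = j, j = m | i = m]).

Definition is_corner (p : R * R) := exists2 k, (k <= n)%N & p = pb k%:R.

Lemma nat_offset (i j : nat) (s t : R) : 0 < s < 1 -> 0 <= t <= 1 ->
  i%:R + s = j%:R + t -> i = j /\ s = t.
Proof.
move=> /andP[s0 s1] /andP[t0 t1] ij.
have ij' : i = j.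
  apply/eqP; rewrite eqn_leq -ltnS -[(j <= i)%N]ltnS -!(ltr_nat R) -!natr1.
  by apply/andP; split; lra.
by split=> //; move: ij; rewrite ij' => /addrI.
Qed.

Lemma corner_offset (i : nat) (s : R) : (i < n)%N -> 0 <= s <= 1 ->
  is_corner (pb (i%:R + s)) -> s = 0 \/ s = 1.
Proof.
move=> iN /andP[s0 s1] [k kn pk].
have [->|s0'] := eqVneq s 0; first by left.
have [->|s1'] := eqVneq s 1; first by right.
have s01 : 0 < s < 1 by rewrite !lt_neqAle eq_sym s0' s0 s1' s1.
have iR : i%:R + 1 <= n%:R :> R by rewrite natr1 ler_nat.
have ige0 : 0 <= i%:R :> R by [].
have kR : k%:R <= n%:R :> R by rewrite ler_nat.
have [||eq_k|[[] eq_n _]] := polygon_boundary_eq n0 _ _ pk.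
- by apply/andP; split; lra.
- by rewrite ler0n.
- by have [] := @nat_offset i k s 0 s01; rewrite ?lexx ?ler01 ?addr0 // => _ ss; left.
- lra.
- lra.
Qed.

Lemma offset_corner (i : nat) (s : R) : (i < n)%N -> s = 0 \/ s = 1 ->
  is_corner (pb (i%:R + s)).
Proof.
move=> iN [->|->]; first by exists i; [exact: ltnW | rewrite addr0].
by exists i.+1 => //; rewrite natr1.
Qed.

Lemma glued_sym p p' : glued w p p' -> @glued R w p' p.
Proof.
move=> [i [j [s [[iN jN] lij s01 -> ->]]]].
exists j, i, (if signN i == signN j then s else 1 - s); split=> //.
- by case: ifP => // _; move: s01 => /andP[s0 s1]; apply/andP; split; lra.
- rewrite [signN j == _]eq_sym; case: (signN i == signN j) => //.
  by rewrite subKr.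
Qed.

Lemma glued_corner p p' : glued w p p' -> is_corner p -> is_corner p'.
Proof.
move=> [i [j [s [[iN jN] lij s01 -> ->]]]] /corner_offset -/(_ iN s01) s_end.
apply: offset_corner => //; case: ifP => // _.
by case: s_end => ->; [right|left]; rewrite ?subr0 ?subrr.
Qed.

Definition identified (p p' : R * R) :=
  [\/ p = p', glued w p p' | is_corner p /\ is_corner p'].

Lemma glued_trans p p' p'' : glued w p p' -> glued w p' p'' -> identified p p''.
Proof.
move=> g1 g2; have [c'|nc'] := pselect (is_corner p').
  by apply: Or33; split; [apply: glued_corner (glued_sym g1) c' | apply: glued_corner g2 c'].
have [i [j [s [[iN jN] lij s01 pE pE']]]] := g1.
have [j' [m [u [[jN' mN] ljm u01 pE2 pE3]]]] := g2.
set s' := if _ then s else 1 - s in pE'.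
have s'01 : 0 <= s' <= 1.
  by rewrite /s'; case: ifP => // _; move: s01 => /andP[? ?]; apply/andP; split; lra.
have s'01' : 0 < s' < 1.
  move: s'01 => /andP[s0 s1]; rewrite !lt_neqAle s0 s1 !andbT eq_sym.
  by apply/andP; split; apply/eqP => s'E; apply: nc'; rewrite pE'; apply: offset_corner; auto.
have [jj su] : j = j' /\ s' = u.
  apply: nat_offset => //.
  have jR : j%:R + 1 <= n%:R :> R by rewrite natr1 ler_nat.
  have jR' : j'%:R + 1 <= n%:R :> R by rewrite natr1 ler_nat.
  have [ge ge'] : 0 <= j%:R :> R /\ 0 <= j'%:R :> R by [].
  move: s'01' u01 => /andP[? ?] /andP[? ?].
  have [|||//|[[] ? _]] := @polygon_boundary_eq R n n0 (j%:R + s') (j'%:R + u).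
  - by apply/andP; split; lra.
  - by apply/andP; split; lra.
  - by rewrite -pE' -pE2.
  - lra.
  - lra.
have [ij|jm|im] := pairing iN jN mN lij (etrans (congr1 (fun k => letterN k) jj) ljm).
- have -> : p = p' by rewrite pE pE' /s' ij eqxx.
  exact: Or32.
- have <- : p' = p'' by rewrite pE2 pE3 -jj jm eqxx.
  exact: Or32.
- apply: Or31; rewrite pE pE3 -im -jj -su /s' [signN j == _]eq_sym.
  by case: (signN i == signN j); rewrite // subKr.
Qed.

Lemma identifiedP p p' : clos_refl_sym_trans _ (glued w) p p' -> identified p p'.
Proof.
elim=> [x y xy|x|x y _ [->|xy|[cx cy]]|x y z _ xy _ yz].
- exact: Or32.
- exact: Or31.
- exact: Or31.
- by apply: Or32; exact: glued_sym.
- exact: Or33.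
case: xy => [->//|xy|[cx cy]]; case: yz => [<-|yz|[cy' cz]].
- exact: Or32.
- exact: glued_trans xy yz.
- by apply: Or33; split=> //; apply: glued_corner (glued_sym xy) cy'.
- exact: Or33.
- by apply: Or33; split=> //; apply: glued_corner yz cy.
- exact: Or33.
Qed.

End Gluing.

(** * Polar coordinates on the glued polygon *)

(** Clamping the radius makes the polar parametrization a map on the whole
    plane, continuous without restriction. *)
Definition clamp {R : realType} (r : R) : R := Num.max 0 (Num.min 1 r).

Lemma clamp_id {R : realType} (r : R) : 0 <= r <= 1 -> clamp r = r.
Proof. by move=> /andP[r0 r1]; rewrite /clamp min_r // max_r. Qed.

Lemma clamp_bounds {R : realType} (r : R) : 0 <= clamp r <= 1.
Proof. by rewrite /clamp le_max lexx /= ge_max ler01 ge_min lexx. Qed.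

Lemma clamp_continuous {R : realType} : continuous (@clamp R).
Proof.
move=> r; apply: (@continuous_max R R (cst 0) (fun r => Num.min 1 r)).
  exact: cvg_cst.
apply: (@continuous_min R R (cst 1) id); [exact: cvg_cst | exact: cvg_id].
Qed.

Section PolarMap.
Context {R : realType} {w : word} {X : topologicalType} {q : R * R -> X}.
Notation n := (size w).
Notation pb := (@polygon_boundary R n).
Context (n0 : (0 < n)%N).
Context (qc : {within disc, continuous q}) (qs : q @` disc = setT).
Context (qP : forall p p', disc p -> disc p' ->
  (q p = q p' <-> clos_refl_sym_trans _ (glued w) p p')).
Context {ell : nat} {letter : 'I_n -> 'I_ell} {occ1 occ2 : 'I_ell -> 'I_n}.
Context (letterE : forall k : 'I_n, (nth (0, true)%N w k).1 = letter k).
Context (occP : forall k c, (letter k == c) = (k == occ1 c) || (k == occ2 c)).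

Let sgn (k : 'I_n) := (nth (0, true)%N w k).2.

Let pairing i j m : (i < n)%N -> (j < n)%N -> (m < n)%N ->
  (nth (0, true)%N w i).1 = (nth (0, true)%N w j).1 ->
  (nth (0, true)%N w j).1 = (nth (0, true)%N w m).1 -> [\/ i = j, j = m | i = m].
Proof.
move=> iN jN mN; rewrite (letterE (Ordinal iN)) (letterE (Ordinal jN)) (letterE (Ordinal mN)).
move=> /val_inj ij /val_inj jm.
have := occP (Ordinal iN) (letter (Ordinal jN)); rewrite ij eqxx => /esym.
have := occP (Ordinal mN) (letter (Ordinal jN)); rewrite -jm eqxx => /esym.
have := occP (Ordinal jN) (letter (Ordinal jN)); rewrite eqxx => /esym.
case/orP=> /eqP jE; case/orP=> /eqP mE; case/orP=> /eqP iE.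
all: try by apply: Or31; have := congr1 val (etrans iE (esym jE)).
all: try by apply: Or32; have := congr1 val (etrans jE (esym mE)).
all: by apply: Or33; have := congr1 val (etrans iE (esym mE)).
Qed.

Definition ray (p : R * R) : R * R := (clamp p.1 * (pb p.2).1, clamp p.1 * (pb p.2).2).
Definition polar (p : R * R) : X := q (ray p).

Lemma ray_disc p : disc (ray p).
Proof.
rewrite /disc /= !exprMn -mulrDr polygon_boundary_circle mulr1.
have /andP[c0 c1] := clamp_bounds p.1.
by rewrite expr_le1.
Qed.

Lemma ray_continuous : continuous ray.
Proof.
have c1 : continuous (fun p : R * R => clamp p.1).
  by move=> p; apply: (@continuous_comp _ _ _ fst); [exact: cvg_fst | exact: clamp_continuous].
have pbc : continuous (fun p : R * R => pb p.2).
  by move=> p; apply: (@continuous_comp _ _ _ snd);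
    [exact: cvg_snd | exact: polygon_boundary_continuous].
have c2 : continuous (fun p : R * R => (pb p.2).1).
  by move=> p; apply: (@continuous_comp _ _ _ (fun p => pb p.2) fst); [exact: pbc | exact: cvg_fst].
have c3 : continuous (fun p : R * R => (pb p.2).2).
  by move=> p; apply: (@continuous_comp _ _ _ (fun p => pb p.2) snd); [exact: pbc | exact: cvg_snd].
move=> p; exact: cvg_pair (cvgM (c1 p) (c2 p)) (cvgM (c1 p) (c3 p)).
Qed.

Lemma polar_continuous : continuous polar.
Proof.
move=> p; have /subspace_continuousP/(_ _ (ray_disc p)) qcp := qc.
move=> U /qcp qU; have : nbhs (ray p) [set p' | disc p' -> U (q p')] := qU.
move=> /(ray_continuous (x := p)) nW.
exact: (filterS (fun p' h => h (ray_disc p')) nW).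
Qed.

Lemma polar_surj x : exists p, [/\ 0 <= p.1 <= 1, 0 <= p.2 < n%:R & polar p = x].
Proof.
have [p pd <-] : (q @` disc) x by rewrite qs.
pose r := Num.sqrt (p.1 ^+ 2 + p.2 ^+ 2).
have r2 : r ^+ 2 = p.1 ^+ 2 + p.2 ^+ 2 by rewrite sqr_sqrtr // addr_ge0 ?sqr_ge0.
have r0 : 0 <= r by exact: sqrtr_ge0.
have r1 : r <= 1 by rewrite -(@expr_le1 _ 2) // r2.
have [rE|rN] := eqVneq r 0.
  exists (0, 0) => /=; rewrite lexx ler01 ltr0n; split=> //.
  rewrite /polar /ray /= clamp_id ?lexx ?ler01 // !mul0r; congr q.
  have : p.1 ^+ 2 + p.2 ^+ 2 = 0 by rewrite -r2 rE expr0n.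
  move/eqP; rewrite paddr_eq0 ?sqr_ge0 // !sqrf_eq0 => /andP[/eqP p1 /eqP p2].
  by case: p p1 p2 {pd r r2 r0 r1 rE} => /= ? ? -> ->.
have [|t t01 tE] := @polygon_boundary_surj R n n0 (p.1 / r) (p.2 / r).
  by rewrite !expr_div_n -mulrDl -r2 divff // sqrf_eq0.
exists (r, t); rewrite /= r0 r1; split=> //.
rewrite /polar; have -> : ray (r, t) = (r * (pb t).1, r * (pb t).2) by rewrite /ray clamp_id //= r0.
by rewrite tE /= !(mulrC r) !divfK // -surjective_pairing.
Qed.

Definition in_rect (p : R * R) := 0 <= p.1 <= 1 /\ 0 <= p.2 <= n%:R.
Definition at_end (x : R) := x = 0 \/ x = n%:R.

Lemma ray_eq p p' : in_rect p -> in_rect p' -> ray p = ray p' ->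
  p.1 = p'.1 /\ (p.1 = 0 \/ p.2 = p'.2 \/ at_end p.2 /\ at_end p'.2).
Proof.
move=> [p1 p2] [p'1 p'2]; rewrite /ray !clamp_id // => -[e1 e2].
have rr : p.1 = p'.1.
  apply/eqP; rewrite -(@eqrXn2 _ 2) ?(andP p1).1 ?(andP p'1).1 //.
  have sqE (a : R * R) : a.1 ^+ 2 = (a.1 * (pb a.2).1) ^+ 2 + (a.1 * (pb a.2).2) ^+ 2.
    by rewrite !exprMn -mulrDr polygon_boundary_circle mulr1.
  by rewrite (sqE p) (sqE p') e1 e2.
split=> //; have [->|rN] := eqVneq p.1 0; [by left|right].
have pE : pb p.2 = pb p'.2.
  move: e1 e2; rewrite -rr => /(mulfI rN) e1 /(mulfI rN) e2.
  by apply: injective_projections; [exact: e1 | exact: e2].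
by have [->|[]] := polygon_boundary_eq n0 p2 p'2 pE; [left | right].
Qed.

Lemma ray_pb p x : in_rect p -> 0 <= x <= n%:R -> ray p = pb x ->
  p.1 = 1 /\ (p.2 = x \/ at_end p.2 /\ at_end x).
Proof.
move=> pr x0 px; have [|||p1 []] := @ray_eq p (1, x).
- exact: pr.
- by split=> //=; rewrite ler01 lexx.
- by rewrite px /ray /= clamp_id ?ler01 ?lexx // !mul1r.
- by rewrite p1 => /eqP; rewrite oner_eq0.
- by move=> h; split.
Qed.

Definition is_nat (x : R) := exists2 m : nat, (m <= n)%N & x = m%:R.

Lemma at_end_nat x : at_end x -> is_nat x.
Proof. by case=> ->; [exists 0%N | exists n]. Qed.

Lemma ray_corner p : in_rect p -> is_corner (w := w) (ray p) -> p.1 = 1 /\ is_nat p.2.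
Proof.
move=> pr [m mn /ray_pb -/(_ pr)[]]; first by rewrite ler0n ler_nat.
by move=> -> [->|[/at_end_nat]]; split=> //; exists m.
Qed.

(** The point at parameter t on side k in the direction of its letter. *)
Definition on_side (k : 'I_n) (t : R) : R := k%:R + (if sgn k then t else 1 - t).

Lemma at_end_offset (k : nat) (s : R) : (k < n)%N -> 0 <= s <= 1 ->
  at_end (k%:R + s) -> s = 0 \/ s = 1.
Proof.
move=> kn /andP[s0 s1]; have kn' : k%:R + 1 <= n%:R :> R by rewrite natr1 ler_nat.
have k0 : 0 <= k%:R :> R by [].
by case=> h; [left|right]; lra.
Qed.

(** The four ways in which two points of the rectangle are identified: at the
    centre, at the same point of the disc, at corners, or at glued inner
    points of two sides. *)
Lemma polar_eq p p' : in_rect p -> in_rect p' -> polar p = polar p' ->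
  [\/ p.1 = 0 /\ p'.1 = 0,
      p.1 = p'.1 /\ (p.2 = p'.2 \/ at_end p.2 /\ at_end p'.2),
      p.1 = 1 /\ p'.1 = 1 /\ is_nat p.2 /\ is_nat p'.2 |
      p.1 = 1 /\ p'.1 = 1 /\ exists k k' t, [/\ letter k = letter k', 0 < t < 1,
        p.2 = on_side k t & p'.2 = on_side k' t]].
Proof.
move=> pr pr' /(qP (ray_disc p) (ray_disc p')) /(identifiedP n0 pairing)[eq_ray||[cp cp']].
- have [rr [r0|h]] := ray_eq pr pr' eq_ray; [apply: Or41 | exact: Or42].
  by rewrite -rr.
- move=> [i [j [s [[iN jN] lij s01 pi' pj]]]].
  set s' := if _ then _ else _ in pj.
  have s'01 : 0 <= s' <= 1.
    by rewrite /s'; case: ifP => // _; move: s01 => /andP[? ?]; apply/andP; split; lra.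
  have bnd (m : nat) (u : R) : (m < n)%N -> 0 <= u <= 1 -> 0 <= m%:R + u <= n%:R.
    move=> mN /andP[u0 u1]; have mn : m%:R + 1 <= n%:R :> R by rewrite natr1 ler_nat.
    by have m0 : 0 <= m%:R :> R by []; apply/andP; split; lra.
  have [p1 p2] := ray_pb pr (bnd _ _ iN s01) pi'.
  have [p'1 p'2] := ray_pb pr' (bnd _ _ jN s'01) pj.
  have [send|smid] : (s = 0 \/ s = 1) \/ 0 < s < 1.
    have [->|sn0] := eqVneq s 0; first by left; left.
    have [->|sn1] := eqVneq s 1; first by left; right.
    by right; move: s01 => /andP[? ?]; rewrite !lt_neqAle eq_sym sn0 sn1; apply/andP.
  + apply: Or43; split=> //; split=> //.
    have s'end : s' = 0 \/ s' = 1.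
      by rewrite /s'; case: ifP => // _; case: send => ->; rewrite ?subr0 ?subrr; auto.
    have nat_end (m : nat) (u x : R) : (m < n)%N -> u = 0 \/ u = 1 ->
        x = m%:R + u \/ at_end x /\ at_end (m%:R + u) -> is_nat x.
      move=> mN [->|->] [->|[/at_end_nat//]].
        by exists m; [exact: ltnW | rewrite addr0].
      by exists m.+1 => //; rewrite natr1.
    by split; [apply: nat_end p2 | apply: nat_end p'2].
  + have s'mid : 0 < s' < 1.
      by rewrite /s'; case: ifP => // _; move: smid => /andP[? ?]; apply/andP; split; lra.
    apply: Or44; split=> //; split=> //.
    exists (Ordinal iN), (Ordinal jN), (if sgn (Ordinal iN) then s else 1 - s).
    split.
    * by apply: val_inj; rewrite /= -!letterE.
    * by case: ifP => // _; move: smid => /andP[? ?]; apply/andP; split; lra.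
    * case: p2 => [->|[_ /at_end_offset -/(_ iN s01)]]; last by case: smid => /[swap] -[->|->]; rewrite ltxx ?andbF.
      by rewrite /on_side /=; case: (sgn _); rewrite ?subKr.
    * case: p'2 => [->|[_ /at_end_offset -/(_ jN s'01)]]; last by case: s'mid => /[swap] -[->|->]; rewrite ltxx ?andbF.
      rewrite /on_side /s' /sgn /=.
      by do 2!case: (nth _ _ _).2; rewrite //= ?subKr.
- apply: Or43.
  have [? ?] := ray_corner pr cp; have [? ?] := ray_corner pr' cp'.
  by split.
Qed.

Lemma polar_glued k k' t : letter k = letter k' -> 0 <= t <= 1 ->
  polar (1, on_side k t) = polar (1, on_side k' t).
Proof.
move=> kk' t01; apply/qP; [exact: ray_disc.. |].
have rayE x : ray (1, x) = pb x.
  by rewrite /ray /= clamp_id ?ler01 ?lexx // !mul1r.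
rewrite !rayE; apply: rst_step.
exists k, k', (if sgn k then t else 1 - t); split=> //.
- by rewrite !letterE kk'.
- by case: ifP => // _; move: t01 => /andP[? ?]; apply/andP; split; lra.
- rewrite /on_side -/(sgn k) -/(sgn k'); congr (pb (_ + _)).
  by case: (sgn k); case: (sgn k'); rewrite //= subKr.
Qed.

Lemma polar_period r x : polar (r, x + n%:R) = polar (r, x).
Proof. by rewrite /polar /ray -[(r, x + n%:R).2]/(x + n%:R) polygon_boundary_period. Qed.

Lemma polar_origin x y : polar (0, x) = polar (0, y).
Proof. by rewrite /polar /ray /= clamp_id ?lexx ?ler01 // !mul0r. Qed.

End PolarMap.

(** * The cells of the polar grid *)

Lemma rank_spot_lt {n L' : nat} (j : @spot n L') : (rank_spot j < n * L'.+1)%N.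
Proof.
case: j => k l; rewrite /rank_spot /=; have kn := ltn_ord k; have lL := ltn_ord l.
have : (k.+1 * L'.+1 <= n * L'.+1)%N by rewrite leq_mul2r kn orbT.
by rewrite mulSn; lia.
Qed.

Lemma rank_spot_succ {n L' : nat} (j j' : @spot n L') :
  rank_spot j' = (rank_spot j).+1 -> j' = nxt j.
Proof.
move=> jj'; apply: rank_spot_inj; rewrite rank_spot_nxt // lt0n.
by apply/eqP => /(rank_spot_last j'); rewrite jj' ltnn.
Qed.

Lemma rank_spot_wrap {n L' : nat} (j j' : @spot n L') :
  rank_spot j = 0%N -> (rank_spot j').+1 = (n * L'.+1)%N -> nxt j' = j.
Proof.
move=> j0 j'n; apply: rank_spot_inj; rewrite j0; apply/eqP.
rewrite -leqn0 leqNgt; apply/negP => /rank_spot_nxt r.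
by have := rank_spot_lt (nxt j'); rewrite r j'n ltnn.
Qed.

Section Grid.
Context {R : realType} {w : word} {X : topologicalType} {q : R * R -> X}.
Notation n := (size w).
Context (n0 : (0 < n)%N).
Context (qc : {within disc, continuous q}) (qs : q @` disc = setT).
Context (qP : forall p p', disc p -> disc p' ->
  (q p = q p' <-> clos_refl_sym_trans _ (glued w) p p')).
Context {ell : nat} {letter : 'I_n -> 'I_ell} {occ1 occ2 : 'I_ell -> 'I_n}.
Context (letterE : forall k : 'I_n, (nth (0, true)%N w k).1 = letter k).
Context (occP : forall k c, (letter k == c) = (k == occ1 c) || (k == occ2 c)).
Context {L' N1 : nat}.
Notation L := L'.+1.
Notation N := N1.+1.
Notation polar := (@polar R w X q).
Notation on_side := (@on_side R w).
Notation spot := (@spot n L').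
Notation gvertex := (@gvertex n ell L' N1).
Notation gface := (@gface n L' N1).

Definition sgn (k : 'I_n) := (nth (0, true)%N w k).2.

(** A corner of the same class as k that depends only on the class, because
    the choice ranges over the whole class. *)
Definition cc (k : 'I_n) : 'I_n :=
  odflt k [pick k' : 'I_n | `[< polar (1, (nat_of_ord k)%:R) = polar (1, (nat_of_ord k')%:R) >]].

Lemma cc_polar (k : 'I_n) : polar (1, (nat_of_ord k)%:R) = polar (1, (nat_of_ord (cc k))%:R).
Proof. by rewrite /cc; case: pickP => [k' /asboolP|]. Qed.

Lemma ccP (k k' : 'I_n) : polar (1, (nat_of_ord k)%:R) = polar (1, (nat_of_ord k')%:R) -> cc k = cc k'.
Proof.
move=> kk'; rewrite /cc.
rewrite (eq_pick (_ : _ =1 (fun i : 'I_n =>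
  `[< polar (1, (nat_of_ord k')%:R) = polar (1, (nat_of_ord i)%:R) >]))); last first.
  by move=> i; rewrite kk'.
by case: pickP => // /(_ k') /asboolPn.
Qed.

Lemma polar_ordS (k : 'I_n) : polar (1, (nat_of_ord (ordS k))%:R) = polar (1, k.+1%:R).
Proof.
rewrite /=; have kn := ltn_ord k; have [->|kn'] := eqVneq k.+1 n.
  by rewrite modnn -(polar_period n0) add0r.
by rewrite modn_small //; lia.
Qed.

Lemma polar_start k : polar (1, on_side k 0) = polar (1, (nat_of_ord (cstart (sgn := sgn) k))%:R).
Proof.
rewrite /on_side /cstart -/(sgn k); case: (sgn k); first by rewrite addr0.
by rewrite subr0 natr1 polar_ordS.
Qed.

Lemma polar_end k : polar (1, on_side k 1) = polar (1, (nat_of_ord (cend (sgn := sgn) k))%:R).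
Proof.
rewrite /on_side /cend -/(sgn k); case: (sgn k); last by rewrite subrr addr0.
by rewrite natr1 polar_ordS.
Qed.

Lemma cc_glued k k' : letter k = letter k' ->
  cc (cstart (sgn := sgn) k) = cc (cstart (sgn := sgn) k') /\
  cc (cend (sgn := sgn) k) = cc (cend (sgn := sgn) k').
Proof.
move=> kk'; split; apply: ccP; rewrite -?polar_start -?polar_end.
  by apply: (polar_glued qP letterE kk'); rewrite lexx ler01.
by apply: (polar_glued qP letterE kk'); rewrite lexx ler01.
Qed.

Notation vtx := (@vtx n ell L' N1 letter sgn cc).
Notation bv := (@bv n ell L' N1 letter sgn cc).

Definition gpt (i : nat) (j : spot) : R * R := (i%:R / N%:R, (rank_spot j)%:R / L%:R).

Definition pos (x : gvertex) : X := match x with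
  | inl (inl (inl _)) => polar (0, 0)
  | inl (inl (inr (i, j))) => polar (gpt i.+1 j)
  | inl (inr (c, t)) => polar (1, on_side (occ1 c) ((nat_of_ord t)%:R / L%:R))
  | inr k => polar (1, (nat_of_ord k)%:R)
  end.

Lemma spot_coord (k : 'I_n) (l : 'I_L) :
  (rank_spot (k, l))%:R / L%:R = (nat_of_ord k)%:R + (nat_of_ord l)%:R / L%:R :> R.
Proof. by rewrite /rank_spot /= natrD natrM mulrDl mulfK // pnatr_eq0. Qed.

Lemma vtx_pos i j : (i <= N)%N -> pos (vtx i j) = polar (gpt i j).
Proof.
case: i => [|i] iN; first by rewrite /gpt mul0r /=; apply: polar_origin.
have [iN1|iN1] := ltnP i N1.
  by rewrite (vtx_inner (Ordinal iN1)).
have -> : i = N1 by lia.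
rewrite vtx_bv /gpt divff ?pnatr_eq0 //.
case: j => k l; rewrite /bv spot_coord /=; case: eqVneq => [->|l0] /=.
  by rewrite mul0r addr0 -cc_polar.
have lL := ltn_ord l; have L0 : L%:R != 0 :> R by rewrite pnatr_eq0.
have l0' : (0 < l)%N by rewrite lt0n.
have occ1l : letter (occ1 (letter k)) = letter k by apply/eqP; rewrite occP eqxx.
rewrite (polar_glued qP letterE occ1l); last first.
  rewrite divr_ge0 //= ler_pdivrMr ?ltr0n // mul1r ler_nat.
  by case: (sgn k); [exact: ltnW | rewrite inordK; lia].
congr (polar (_, _)); rewrite /on_side -/(sgn k); case: (sgn k) => //.
rewrite inordK; last by lia.
by rewrite natrB 1?ltnW // mulrBl divff // subKr.
Qed.

Definition cell (f : gface) : set (R * R) := [set p |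
  f.1%:R / N%:R <= p.1 <= f.1.+1%:R / N%:R /\
  (rank_spot f.2)%:R / L%:R <= p.2 <= (rank_spot f.2).+1%:R / L%:R].

Definition cverts (f : gface) : {set gvertex} :=
  [set x | [|| x == vtx f.1 f.2, x == vtx f.1 (nxt f.2), x == vtx f.1.+1 f.2 |
               x == vtx f.1.+1 (nxt f.2)]]%SET.

Lemma cvertsP (f : gface) i j : i = f.1 :> nat \/ i = f.1.+1 -> j = f.2 \/ j = nxt f.2 ->
  vtx i j \in cverts f.
Proof. by move=> [->|->] [->|->]; rewrite inE eqxx ?orbT. Qed.

Lemma scale_bounds (m i : nat) (y : R) : (0 < m)%N ->
  (i%:R / m%:R <= y <= i.+1%:R / m%:R) = (i%:R <= y * m%:R <= i.+1%:R).
Proof. by move=> m0; rewrite ler_pdivrMr ?ltr0n // ler_pdivlMr ?ltr0n. Qed.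

Lemma cell_rect f p : cell f p -> in_rect (w := w) p.
Proof.
rewrite /cell /= !scale_bounds // => -[/andP[a b] /andP[c d]].
have iN : f.1.+1%:R <= N%:R :> R by rewrite ler_nat.
have jL : (rank_spot f.2).+1%:R <= (n * L)%:R :> R by rewrite ler_nat rank_spot_lt.
have N0 : 0 < N%:R :> R by rewrite ltr0n.
have L0 : 0 < L%:R :> R by rewrite ltr0n.
split; apply/andP; split.
- by rewrite -(pmulr_lge0 _ N0); apply: le_trans a.
- by rewrite -(ler_pM2r N0) mul1r; apply: le_trans b iN.
- by rewrite -(pmulr_lge0 _ L0); apply: le_trans c.
- by rewrite -(ler_pM2r L0) -natrM; apply: le_trans d jL.
Qed.

Lemma unit_overlap (a b : nat) (y : R) : a%:R <= y <= a.+1%:R -> b%:R <= y <= b.+1%:R ->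
  [\/ a = b, b = a.+1 | a = b.+1].
Proof.
move=> /andP[a1 a2] /andP[b1 b2].
have ab : (a <= b.+1)%N by rewrite -(ler_nat R); apply: le_trans a1 b2.
have ba : (b <= a.+1)%N by rewrite -(ler_nat R); apply: le_trans b1 a2.
have [lt_ab|lt_ba|->] := ltngtP a b; last exact: Or31.
  by apply: Or32; lia.
by apply: Or33; lia.
Qed.

Lemma nat_unit (m b : nat) : b%:R <= (m%:R : R) <= b.+1%:R -> m = b \/ m = b.+1.
Proof. rewrite !ler_nat; lia. Qed.

Lemma outer_ring (f : gface) p : cell f p -> p.1 = 1 -> f.1.+1 = N :> nat.
Proof.
rewrite /cell /= scale_bounds // => -[/andP[_ h] _] p1; move: h.
rewrite p1 mul1r ler_nat => h; apply/eqP; rewrite eqn_leq h andbT.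
exact: ltn_ord.
Qed.

Lemma corner_cvert (f : gface) p (m : nat) : cell f p -> p.1 = 1 -> (m <= n)%N ->
  p.2 = m%:R -> exists2 k : 'I_n, inr (cc k) \in cverts f &
    polar (1, (nat_of_ord k)%:R) = polar (1, m%:R).
Proof.
move=> pf p1 mn p2; have fN := outer_ring pf p1.
move: pf => [_]; rewrite p2 scale_bounds // -natrM => /nat_unit.
case: f fN => i [k l] /= fN; rewrite {1 2}/rank_spot /= => mL.
have lL := ltn_ord l.
have bvE j : vtx i.+1 j = bv j by rewrite fN vtx_bv.
case: mL => mL.
  have l0 : l = 0%N :> nat.
    by have := congr1 (modn^~ L) mL; rewrite modnMl modnMDl modn_small.
  have mk : m = k.
    by move: mL; rewrite l0 addn0 => /eqP; rewrite eqn_mul2r /= => /eqP.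
  exists k; last by rewrite mk.
  have -> : inr (cc k) = vtx i.+1 (k, l) :> gvertex.
    by rewrite bvE /bv -val_eqE /= l0.
  by apply: cvertsP; [right | left].
have lL1 : l.+1 = L.
  have [//|lL1] := eqVneq l.+1 L; have lL2 : (l.+1 < L)%N by lia.
  by have := congr1 (modn^~ L) mL; rewrite -addnS modnMl modnMDl modn_small.
have mk : m = k.+1.
  by move: mL; rewrite -addnS lL1 -mulSnr => /eqP; rewrite eqn_mul2r /= => /eqP.
exists (ordS k); last by rewrite polar_ordS mk.
have -> : inr (cc (ordS k)) = vtx i.+1 (nxt (k, l)) :> gvertex.
  by rewrite bvE /nxt /= lL1 ltnn.
by apply: cvertsP; right.
Qed.

Lemma side_cvert (f : gface) p (k : 'I_n) (t : R) : cell f p -> p.1 = 1 -> 0 < t < 1 ->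
  p.2 = on_side k t -> exists c : nat, c%:R <= t * L%:R <= c.+1%:R /\
    forall b, b = c \/ b = c.+1 -> @letter_vtx n ell L' N1 letter sgn cc k b \in cverts f.
Proof.
move=> pf p1 /andP[t0 t1] p2; have fN := outer_ring pf p1.
move: pf => [_]; rewrite p2 scale_bounds //.
case: f fN => i [k' l] /= fN; rewrite /on_side -/(sgn k) mulrDl -natrM => sl.
have lL := ltn_ord l; have L0 : 0 < L%:R :> R by rewrite ltr0n.
set s := if _ then t else _ in sl.
have [s0 s1] : 0 < s * L%:R /\ s * L%:R < L%:R.
  by rewrite /s; case: (sgn k); rewrite pmulr_lgt0 // gtr_pMl //; lra.
have kk' : k' = k.
  apply/val_inj/eqP; rewrite eqn_leq; case/andP: sl => sl1 sl2.
  have : (k' * L + l < k.+1 * L)%N.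
    by rewrite -(ltr_nat R); apply: le_lt_trans sl1 _; rewrite mulSnr natrD ltrD2l.
  have : (k * L < (k' * L + l).+1)%N.
    by rewrite -(ltr_nat R); apply: lt_le_trans sl2; rewrite ltrDl.
  move=> h2 h1; apply/andP; split; rewrite leqNgt; apply/negP => lt_k.
    have := leq_mul lt_k (leqnn L); move: h1.
    by move: (k.+1 * L)%N (k' * L)%N => x y; lia.
  have := leq_mul lt_k (leqnn L); rewrite [(k'.+1 * L)%N]mulSn; move: h2.
  by move: (k * L)%N (k' * L)%N => x y; lia.
subst k'.
have sl' : (nat_of_ord l)%:R <= s * L%:R <= l.+1%:R.
  by move: sl; rewrite /rank_spot /= -addnS !natrD !lerD2l.
pose c : 'I_L := if sgn k then l else rev_ord l.
have kc : (k, l) = along (sgn := sgn) k c.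
  by rewrite /along /c; case: (sgn k); rewrite ?rev_ordK.
exists c; split.
  have revE : (nat_of_ord (rev_ord l))%:R + l.+1%:R = L%:R :> R.
    by rewrite -natrD /= subnK.
  move: sl' revE; rewrite /s /c; case: (sgn k) => //.
  rewrite mulrBl mul1r -!natr1 => /andP[a b] revE.
  by apply/andP; split; lra.
have [bj bnj] : vtx i.+1 (k, l) \in cverts (i, (k, l)) /\
    vtx i.+1 (nxt (k, l)) \in cverts (i, (k, l)).
  by split; apply: cvertsP; auto.
move: bj bnj; rewrite fN !vtx_bv kc.
have := @along_ends n ell L' N1 letter sgn cc k c.
by case: (sgn k) => -[-> ->] bj bnj b [->|->].
Qed.

(** The combinatorial complex reflects the topology: cells with a common point
    on the surface have a common vertex.  Each case of [polar_eq] gives one: the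
    centre, a vertex shared by neighbouring cells of the rectangle, the common
    corner class, or a vertex of the common letter. *)
Lemma cells_meet f f' p p' : cell f p -> cell f' p' -> polar p = polar p' ->
  exists2 x, x \in cverts f & x \in cverts f'.
Proof.
move=> pf pf' pp'; have pr := cell_rect pf; have pr' := cell_rect pf'.
have [[p1 p'1]|[p1 p2]|[p1 [p'1 [[m mn pm] [m' mn' pm']]]]|] :=
    polar_eq n0 qP letterE occP pr pr' pp'.
- have hub0 g r : cell g r -> r.1 = 0 -> hub \in cverts g.
    rewrite /cell /= scale_bounds // => -[/andP[h _] _] r0; move: h.
    rewrite r0 mul0r lern0 => /eqP g0.
    by rewrite -[hub]/(vtx 0 g.2); apply: cvertsP; [left | left].
  by exists hub; apply: hub0; eassumption.
- have [a [af af']] : exists a, (a = f.1 :> nat \/ a = f.1.+1) /\ (a = f'.1 :> nat \/ a = f'.1.+1).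
    move: (pf) (pf') => [+ _] [+ _]; rewrite -p1 !scale_bounds // => h1 h2.
    case: (unit_overlap h1 h2) => ff'.
    + by exists f.1; auto.
    + by exists f'.1; rewrite ff'; auto.
    + by exists f.1; rewrite ff'; auto.
  have [b [bf bf']] : exists b, (b = f.2 \/ b = nxt f.2) /\ (b = f'.2 \/ b = nxt f'.2).
    move: (pf) (pf') => [_ +] [_ +]; rewrite !scale_bounds // => h1 h2.
    have close : p.2 = p'.2 -> exists b, (b = f.2 \/ b = nxt f.2) /\ (b = f'.2 \/ b = nxt f'.2).
      move=> ee; rewrite -ee in h2; case: (unit_overlap h1 h2) => ff'.
      + by exists f.2; split; left => //; apply: rank_spot_inj.
      + by exists f'.2; split; [right; apply: rank_spot_succ | left].
      + by exists f.2; split; [left | right; apply: rank_spot_succ].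
    have start g (x : R) : x = 0 -> (rank_spot g)%:R <= x * L%:R <= (rank_spot g).+1%:R ->
        rank_spot g = 0%N.
      by move=> -> /andP[+ _]; rewrite mul0r lern0 => /eqP.
    have finish (g : spot) (x : R) : x = n%:R ->
        (rank_spot g)%:R <= x * L%:R <= (rank_spot g).+1%:R -> (rank_spot g).+1 = (n * L)%N.
      move=> -> /andP[_]; rewrite -natrM ler_nat => h; apply/eqP.
      by rewrite eqn_leq h rank_spot_lt.
    case: p2 => [/close//|[[e1|e1] [e2|e2]]].
    + by apply: close; rewrite e1 e2.
    + exists f.2; split; [by left | right].
      by apply/esym/rank_spot_wrap; [exact: start e1 h1 | exact: finish e2 h2].
    + exists f'.2; split; [right | by left].
      by apply/esym/rank_spot_wrap; [exact: start e2 h2 | exact: finish e1 h1].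
    + by apply: close; rewrite e1 e2.
  by exists (vtx a b); apply: cvertsP.
- have [k kf kE] := corner_cvert pf p1 mn pm.
  have [k' kf' kE'] := corner_cvert pf' p'1 mn' pm'.
  exists (inr (cc k)) => //; have -> // : cc k = cc k'.
  apply: ccP; rewrite kE kE' -pm -pm' -{1}p1 -p'1.
  by rewrite -!surjective_pairing.
- move=> [p1 [p'1 [k [k' [t [kk' t01 pk pk']]]]]].
  have [c [ct cf]] := side_cvert pf p1 t01 pk.
  have [c' [ct' cf']] := side_cvert pf' p'1 t01 pk'.
  have [b [bc bc']] : exists b, (b = c \/ b = c.+1) /\ (b = c' \/ b = c'.+1).
    by case: (unit_overlap ct ct') => cc'; [exists c | exists c' | exists c]; auto.
  exists (@letter_vtx n ell L' N1 letter sgn cc k b); first exact: cf.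
  by rewrite (letter_vtx_glued cc_glued b kk'); apply: cf'.
Qed.

End Grid.

Lemma unit_interval_of {R : realType} (m : nat) (y : R) : (0 < m)%N -> 0 <= y <= m%:R ->
  exists2 a, (a < m)%N & a%:R <= y <= a.+1%:R.
Proof.
case: m => // m _; elim: m => [|m IHm] /andP[y0 ym].
  by exists 0%N => //; rewrite y0.
have [ym'|ym'] := leP y m.+1%:R.
  have [|a am ay] := IHm; first by rewrite y0.
  by exists a => //; apply: ltnW.
by exists m.+1 => //; rewrite ltW.
Qed.

Lemma spot_of_rank {n L' a : nat} : (a < n * L'.+1)%N ->
  exists j : @spot n L', rank_spot j = a.
Proof.
move=> an; have kn : (a %/ L'.+1 < n)%N by rewrite ltn_divLR.
exists (Ordinal kn, Ordinal (ltn_pmod a (ltn0Sn L'))).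
by rewrite /rank_spot /= -divn_eq.
Qed.

Section CellNeighbourhoods.
Context {R : realType} {w : word} {X : topologicalType} {q : R * R -> X}.
Notation n := (size w).
Context (n0 : (0 < n)%N) (XH : hausdorff_space X).
Context (qc : {within disc, continuous q}) (qs : q @` disc = setT).
Context (qP : forall p p', disc p -> disc p' ->
  (q p = q p' <-> clos_refl_sym_trans _ (glued w) p p')).
Context {ell : nat} {letter : 'I_n -> 'I_ell} {occ1 occ2 : 'I_ell -> 'I_n}.
Context (letterE : forall k : 'I_n, (nth (0, true)%N w k).1 = letter k).
Context (occP : forall k c, (letter k == c) = (k == occ1 c) || (k == occ2 c)).
Context {L' N1 : nat}.
Notation L := L'.+1.
Notation N := N1.+1.
Notation polar := (@polar R w X q).
Notation spot := (@spot n L').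
Notation gvertex := (@gvertex n ell L' N1).
Notation gface := (@gface n L' N1).
Notation sgn := (@sgn w).
Notation cc := (@cc R w X q).
Notation vtx := (@vtx n ell L' N1 letter sgn cc).
Notation bv := (@bv n ell L' N1 letter sgn cc).
Notation ea := (@ea n ell L' N1 letter sgn occ1 cc).
Notation eb := (@eb n ell L' N1 letter sgn occ1 cc).
Notation cell := (@cell R w L' N1).
Notation cverts := (@cverts R w X q ell letter L' N1).
Notation pos := (@pos R w X q ell occ1 L' N1).
Notation gpt := (@gpt R w L' N1).

Lemma cell_cover x : exists f p, cell f p /\ polar p = x.
Proof.
have [p [p1 /andP[p20 p2n] px]] := polar_surj n0 qs x.
have N0 : 0 < N%:R :> R by rewrite ltr0n.
have L0 : 0 < L%:R :> R by rewrite ltr0n.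
have [|i iN ip] := @unit_interval_of R N (p.1 * N%:R) isT.
  by case/andP: p1 => p10 p11; rewrite pmulr_lge0 // p10 ger_pMl.
have [||a an ap] := @unit_interval_of R (n * L) (p.2 * L%:R).
- by rewrite muln_gt0 n0.
- by rewrite pmulr_lge0 // p20 natrM ler_pM2r // ltW.
have [j ja] := spot_of_rank an.
by exists (Ordinal iN, j), p; split=> //; split; rewrite scale_bounds //= ja.
Qed.

Lemma cell_compact f : compact (cell f).
Proof.
pose a : R := f.1%:R / N%:R; pose b : R := f.1.+1%:R / N%:R.
pose c : R := (rank_spot f.2)%:R / L%:R; pose d : R := (rank_spot f.2).+1%:R / L%:R.
have -> : cell f = `[a, b] `*` `[c, d].
  by apply/seteqP; split=> p /=; rewrite /cell /= !in_itv.
by apply: compact_setX; exact: segment_compact.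
Qed.

Lemma polar_cell_closed f : closed (polar @` cell f).
Proof.
apply: (compact_closed XH); apply: continuous_compact (@cell_compact f).
by apply: continuous_subspaceT; exact: polar_continuous.
Qed.

Lemma adj_boundary j : adj ea eb (bv j) (bv (nxt j)).
Proof.
case: j => k l; pose c : 'I_L := if sgn k then l else rev_ord l.
have kc : (k, l) = along (sgn := sgn) k c.
  by rewrite /along /c; case: (sgn k); rewrite ?rev_ordK.
have o1 : letter (occ1 (letter k)) = letter k by apply/eqP; rewrite occP eqxx.
apply/existsP; exists (inr (letter k, c)) => /=; rewrite kc.
have := @along_ends n ell L' N1 letter sgn cc k c.
have := @along_ends n ell L' N1 letter sgn cc (occ1 (letter k)) c.
rewrite !(letter_vtx_glued (cc_glued n0 qP letterE) _ o1).
by case: (sgn k); case: (sgn _) => -[-> ->] [-> ->]; rewrite !eqxx ?orbT.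
Qed.

Lemma cverts_closed (S A : {set gvertex}) f x :
  (forall y z, y \in A -> z \in S -> adj ea eb y z -> z \in A) ->
  cverts f \subset S -> x \in A -> x \in cverts f -> cverts f \subset A.
Proof.
move=> Acl /fintype.subsetP fS xA xf; case: f fS xf => i j fS xf.
pose y1 := vtx i j; pose y2 := vtx i.+1 j.
pose y3 := vtx i.+1 (nxt j); pose y4 := vtx i (nxt j).
have [S1 S2 S3 S4] : [/\ y1 \in S, y2 \in S, y3 \in S & y4 \in S].
  by split; apply/fS/cvertsP; auto.
have rad j' : adj ea eb (vtx i (nxt j')) (vtx i.+1 (nxt j')).
  by apply/existsP; exists (inl (inl (i, j'))) => /=; rewrite !eqxx.
have a12 : adj ea eb y1 y2.
  have [nxt' _ nxtK] := injF_bij (@nxt_inj n L').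
  by rewrite /y1 /y2 -(nxtK j); apply: rad.
have a43 : adj ea eb y4 y3 by apply: rad.
have a23 : adj ea eb y2 y3.
  have [iN|iN] := ltnP i N1.
    by apply/existsP; exists (inl (inr (Ordinal iN, j))) => /=; rewrite !eqxx.
  have iE : i = N1 :> nat by apply/eqP; rewrite eqn_leq iN andbT -ltnS.
  by rewrite /y2 /y3 iE !vtx_bv; apply: adj_boundary.
have step y z : z \in S -> adj ea eb y z -> y \in A -> z \in A.
  by move=> zS yz yA; apply: Acl yz.
have step' y z : y \in S -> adj ea eb y z -> z \in A -> y \in A.
  by move=> yS; rewrite adj_sym; apply: step.
have [A1 A2 A3 A4] : [/\ y1 \in A, y2 \in A, y3 \in A & y4 \in A].
  move: xf; rewrite inE => /or4P[] /eqP xE; rewrite xE in xA.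
  - have A2 := step _ _ S2 a12 xA; have A3 := step _ _ S3 a23 A2.
    by split=> //; apply: step' a43 A3.
  - have A3 := step _ _ S3 a43 xA; have A2 := step' _ _ S2 a23 A3.
    by split=> //; apply: step' a12 A2.
  - have A3 := step _ _ S3 a23 xA.
    by split=> //; [apply: step' a12 xA | apply: step' a43 A3].
  - have A2 := step' _ _ S2 a23 xA.
    by split=> //; [apply: step' a12 A2 | apply: step' a43 xA].
by apply/fintype.subsetP => z; rewrite inE => /or4P[] /eqP->.
Qed.

Definition near_faces (C : set X) : {set gface} :=
  [set f | `[< exists2 p, cell f p & C (polar p) >]]%SET.
Definition near_verts (C : set X) : {set gvertex} :=
  [set x | [exists f, (f \in near_faces C) && (x \in cverts f)]]%SET.

Lemma cverts_near C f : f \in near_faces C -> cverts f \subset near_verts C.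
Proof.
by move=> fC; apply/fintype.subsetP => x xf; rewrite inE; apply/existsP; exists f; rewrite fC.
Qed.

Lemma cverts_neq0 (f : gface) : vtx f.1 f.2 \in cverts f.
Proof. by apply: cvertsP; left. Qed.

Lemma near_verts_point C y : C y -> exists2 f, f \in near_faces C &
  exists2 p, cell f p & polar p = y.
Proof.
move=> Cy; have [f [p [pf py]]] := cell_cover y.
by exists f; [rewrite inE; apply/asboolP; exists p; rewrite ?py | exists p].
Qed.

Lemma near_verts_meet C C' : C `&` C' !=set0 ->
  exists2 x, x \in near_verts C & x \in near_verts C'.
Proof.
move=> [y [Cy C'y]]; have [f _ [p pf py]] := near_verts_point Cy.
exists (vtx f.1 f.2); apply: (fintype.subsetP (cverts_near _) _ (cverts_neq0 f));
  by rewrite inE; apply/asboolP; exists p; rewrite ?py.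
Qed.

(** Suppose that A is a part of the trace closed under adjacency.  The cells
    with vertices in A and the other cells form two closed sets that cover C.
    They are disjoint, since cells that meet share a vertex and the four
    vertices of a cell are connected to one another.  As C is connected, one of
    the two is empty. *)
Lemma near_verts_conn C : connected C -> conn ea eb (near_verts C).
Proof.
move=> Ccon A AS A0 Acl.
pose FA := [set f | f \in near_faces C /\ cverts f \subset A].
pose FB := [set f | f \in near_faces C /\ ~~ (cverts f \subset A)].
pose U (Fs : set gface) := \bigcup_(f in Fs) (polar @` cell f).
have Uclosed Fs : closed (U Fs).
  by apply: closed_bigcup => [|f _]; [exact: finite_finset | exact: polar_cell_closed].
have AB y : U FA y -> U FB y -> False.
  move=> [f [fC fA] [p pf py]] [f' [f'C f'A] [p' pf' py']].
  have [|x xf xf'] := cells_meet n0 qP letterE occP pf pf'; first by rewrite py py'.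
  move/negP: f'A; apply; apply: (cverts_closed Acl (cverts_near f'C) _ xf').
  exact: (fintype.subsetP fA).
have CAB y : C y -> U FA y \/ U FB y.
  move=> Cy; have [f fC [p pf py]] := near_verts_point Cy.
  have [fA|fA] := boolP (cverts f \subset A); [left|right]; exists f => //; by exists p.
have [x xA] := set0Pn _ A0.
have CUA : C `&` U FA = C.
  apply: Ccon; last by exists (U FA).
    move: (fintype.subsetP AS x xA); rewrite inE => /existsP[f /andP[fC xf]].
    move: (fC); rewrite inE => /asboolP[p pf Cp]; exists (polar p); split=> //.
    exists f; last by exists p.
    by split=> //; apply: (cverts_closed Acl (cverts_near fC) xA xf).
  exists (~` U FB); first by apply: closed_openC.
  apply/seteqP; split=> y [Cy yU]; split=> //; first by move=> /(AB _ yU).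
  by have [] := CAB y Cy.
apply/eqP; rewrite finset.eqEsubset AS /=; apply/fintype.subsetP => y.
rewrite inE => /existsP[f /andP[fC yf]]; apply: contraT => yA; exfalso.
move: (fC); rewrite inE => /asboolP[p pf Cp].
have [] : (C `&` U FA) (polar p) by rewrite CUA.
move=> _ /AB; apply; exists f; last by exists p.
by split=> //; apply: contra yA => /fintype.subsetP; apply.
Qed.

End CellNeighbourhoods.

(** The f-images of small balls cannot meet disjoint closed sets and be centred
    at points with the same image: near a given pair of
    points this follows from openness of the complements of the closed sets if
    the images agree, and from the Hausdorff property if not; compactness makes
    it uniform. *)
Lemma uniform_separation {R : realType} {U : pseudoMetricType R} {X : topologicalType}
    (K : set U) (f : U -> X) (I : finType) (C : I -> set X) :
  hausdorff_space X -> compact K -> continuous f -> (forall i, closed (C i)) ->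
  \forall eta \near (0 : R)^'+, forall i j, C i `&` C j = set0 ->
    forall g g' p p', K g -> K g' -> ball g eta p -> ball g' eta p' ->
      C i (f p) -> C j (f p') -> f g <> f g'.
Proof.
move=> XH Kc fc Ccl.
pose P (eta : R) (gg : U * U) := forall i j, C i `&` C j = set0 ->
  forall p p', ball gg.1 eta p -> ball gg.2 eta p' ->
      C i (f p) -> C j (f p') -> f gg.1 <> f gg.2.
suff : \forall eta \near (0 : R)^'+, K `*` K `<=` P eta.
  apply: filterS => eta Pe i j Cij g g' p p' Kg Kg' gp g'p'.
  exact: (Pe (g, g') (conj Kg Kg') i j Cij p p' gp g'p').
have /compact_near_coveringP cov := compact_setX Kc Kc.
apply: cov => -[g0 g0'] _.
have far (g : U) : exists2 d : R, 0 < d & forall i, ~ C i (f g) -> forall p, ball g d p -> ~ C i (f p).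
  have : \forall p \near g, forall i, ~ C i (f g) -> ~ C i (f p).
    apply: filter_forall => i; have [Ci|nCi] := pselect (C i (f g)).
      by near=> p => nCi; case: (nCi Ci).
    have : nbhs (f g) (~` C i).
      by apply: open_nbhs_nbhs; split=> //; apply: closed_openC.
    by move=> /(fc g) nW; exact: (filterS (fun p h _ => h) nW).
  move=> /nbhs_ballP[d /= d0 dP]; exists d => // i nCi p gp.
  exact: (dP p gp i nCi).
have [fgg'|fgg'] := pselect (f g0 = f g0').
  have [d d0 dP] := far g0; have [d' d'0 dP'] := far g0'.
  exists (ball g0 (d / 2) `*` ball g0' (d' / 2), [set eta : R | eta < d / 2 /\ eta < d' / 2]).
    split => /=; last by near=> eta; split; near: eta; apply: nbhs_right_lt; rewrite divr_gt0.
    exists (ball g0 (d / 2), ball g0' (d' / 2)) => //=.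
    by split; apply: nbhsx_ballx; rewrite divr_gt0.
  move=> [[g g'] eta] /= [[gg0 gg0'] [ed ed']] i j Cij p p' gp g'p' Cp Cp'.
  have gp0 : ball g0 d p.
    by rewrite [d]splitr; apply: ball_triangle gg0 (le_ball (ltW ed) gp).
  have gp0' : ball g0' d' p'.
    by rewrite [d']splitr; apply: ball_triangle gg0' (le_ball (ltW ed') g'p').
  have [Ci|nCi] := pselect (C i (f g0)); last by case: (dP i nCi p gp0).
  have [Cj|nCj] := pselect (C j (f g0')); last by case: (dP' j nCj p' gp0').
  by have : (C i `&` C j) (f g0) by [split => //; rewrite fgg']; rewrite Cij.
move: XH; rewrite open_hausdorff => /(_ (f g0) (f g0')) [|[A B] /=].
  exact/eqP.
rewrite !inE => -[Ag Bg] [Ao Bo AB].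
exists (f @^-1` A `*` f @^-1` B, setT) => /=.
  split; last exact: filterT.
  exists (f @^-1` A, f @^-1` B) => //=; split; apply: fc;
    by apply: open_nbhs_nbhs; split.
move=> [[g g'] eta] /= [[Ag' Bg'] _] i j _ p p' _ _ _ _ eq_f.
by have : (A `&` B) (f g) by [split => //; rewrite eq_f]; rewrite AB.
Unshelve. all: by end_near. Qed.

Section Separation.
Context {R : realType} {w : word} {X : topologicalType} {q : R * R -> X}.
Notation n := (size w).
Context (n0 : (0 < n)%N) (XH : hausdorff_space X).
Context (qc : {within disc, continuous q}) (qs : q @` disc = setT).
Context (qP : forall p p', disc p -> disc p' ->
  (q p = q p' <-> clos_refl_sym_trans _ (glued w) p p')).
Context {ell : nat} {letter : 'I_n -> 'I_ell} {occ1 occ2 : 'I_ell -> 'I_n}.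
Context (letterE : forall k : 'I_n, (nth (0, true)%N w k).1 = letter k).
Context (occP : forall k c, (letter k == c) = (k == occ1 c) || (k == occ2 c)).
Notation polar := (@polar R w X q).

Lemma rect_compact {v : word} : compact (@in_rect R v).
Proof.
have -> : @in_rect R v = `[0, 1] `*` `[0, (size v)%:R].
  by apply/seteqP; split=> p /=; rewrite /in_rect !in_itv.
by apply: compact_setX; exact: segment_compact.
Qed.

(** The point of the rectangle is a corner of the cell.  For a cell at the last
    spot it has second coordinate n, not 0, and is therefore close to p. *)
Lemma cvert_point {L' N1 : nat} (eta : R) (f : @gface n L' N1) x p :
  N1.+1%:R^-1 < eta -> L'.+1%:R^-1 < eta ->
  x \in @cverts R w X q ell letter L' N1 f -> @cell R w L' N1 f p ->
  exists g, [/\ in_rect (w := w) g, ball g eta p &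
    @pos R w X q ell occ1 L' N1 x = polar g].
Proof.
move=> eN eL xf pf; have N0 : 0 < N1.+1%:R :> R by rewrite ltr0n.
have L0 : 0 < L'.+1%:R :> R by rewrite ltr0n.
have [i [a [iP aP xE]]] : exists i a, [/\ i = f.1 :> nat \/ i = f.1.+1,
    a = rank_spot f.2 \/ a = (rank_spot f.2).+1 &
    @pos R w X q ell occ1 L' N1 x = polar (i%:R / N1.+1%:R, a%:R / L'.+1%:R)].
  have fN := ltn_ord f.1; have fN' := ltnW fN.
  have vp := vtx_pos n0 qP letterE occP (L' := L') (N1 := N1).
  have wrap i : polar (@gpt R w L' N1 i (nxt f.2)) =
      polar (i%:R / N1.+1%:R, (rank_spot f.2).+1%:R / L'.+1%:R).
    rewrite /gpt; have [r0|r0] := posnP (rank_spot (nxt f.2)); last by rewrite rank_spot_nxt.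
    have -> : (rank_spot f.2).+1 = (n * L'.+1)%N.
      apply/eqP; rewrite eqn_leq rank_spot_lt /=.
      have nL : (0 < n * L'.+1)%N by rewrite muln_gt0 n0.
      have [j jE] : exists j : @spot n L', rank_spot j = (n * L'.+1).-1.
        by apply: spot_of_rank; rewrite prednK.
      by have := rank_spot_last j r0; rewrite jE -ltnS prednK.
    by rewrite r0 mul0r natrM mulfK ?gt_eqF // -[n%:R]add0r polar_period.
  move: xf; rewrite inE => /or4P[] /eqP->; rewrite vp ?wrap //.
  - by exists f.1, (rank_spot f.2); split; auto.
  - by exists f.1, (rank_spot f.2).+1; split; auto.
  - by exists f.1.+1, (rank_spot f.2); split; auto.
  - by exists f.1.+1, (rank_spot f.2).+1; split; auto.
exists (i%:R / N1.+1%:R, a%:R / L'.+1%:R); split=> //.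
  have iN : (i <= N1.+1)%N by have := ltn_ord f.1; case: iP => ->; [exact: ltnW|].
  have aL : (a <= n * L'.+1)%N by have := rank_spot_lt f.2; case: aP => ->; [exact: ltnW|].
  split => /=; rewrite divr_ge0 //= ler_pdivrMr //.
    by rewrite mul1r ler_nat.
  by rewrite -natrM ler_nat.
have close (m c c0 : nat) (y : R) : 0 < m%:R :> R -> m%:R^-1 < eta -> c = c0 \/ c = c0.+1 ->
    c0%:R / m%:R <= y <= c0.+1%:R / m%:R -> `|c%:R / m%:R - y| < eta.
  move=> m0 me cc0 /andP[y1 y2]; apply: le_lt_trans me.
  have e1 : c0.+1%:R / m%:R = c0%:R / m%:R + m%:R^-1 :> R.
    by rewrite -natr1 mulrDl mul1r.
  rewrite ler_norml; rewrite e1 in y2.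
  by case: cc0 => ->; rewrite ?e1; apply/andP; split; lra.
case: pf => p1 p2; split => /=; [exact: close p1 | exact: close p2].
Qed.

(** A vertex common to both traces would be the image of two points of the
    rectangle, close to points over C i and over C j respectively. *)
Lemma near_verts_disjoint (I : finType) (C : I -> set X) : (forall i, closed (C i)) ->
  exists m : nat, forall i j x, C i `&` C j = set0 ->
    x \in @near_verts R w X q ell letter m m (C i) ->
    x \in @near_verts R w X q ell letter m m (C j) -> False.
Proof.
move=> Ccl.
have sep := uniform_separation XH (@rect_compact w) (polar_continuous (w := w) qc) Ccl.
have [eta [eta0 etaP]] : exists eta : R, 0 < eta /\ forall i j, C i `&` C j = set0 ->
    forall g g' p p', in_rect (w := w) g -> in_rect (w := w) g' -> ball g eta p -> ball g' eta p' ->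
      C i (polar p) -> C j (polar p') -> polar g <> polar g'.
  have pos_near : \forall eta \near (0 : R)^'+, 0 < eta by exact: nbhs_right_gt.
  have [eta [e0 eP]] := filter_ex (filterI pos_near sep).
  by exists eta.
have [m mP] : exists m : nat, m.+1%:R^-1 < eta.
  exists (Num.truncn eta^-1); rewrite invf_plt ?posrE ?ltr0n //.
  exact: truncnS_gt.
exists m => i j x Cij.
rewrite inE => /existsP[f /andP[fi xf]]; rewrite inE => /existsP[f' /andP[fj xf']].
move: fi; rewrite inE => /asboolP[p pf Cp]; move: fj; rewrite inE => /asboolP[p' pf' Cp'].
have [g [gr gp gx]] := cvert_point mP mP xf pf.
have [g' [g'r g'p g'x]] := cvert_point mP mP xf' pf'.
by apply: (etaP i j Cij g g' p p' gr g'r gp g'p Cp Cp'); rewrite -gx -g'x.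
Qed.

End Separation.

(** * Graphs drawn on a glued polygon *)

Section Drawing.
Context {R : realType} {X : topologicalType} {T : finType} {e : rel T}.
Context (es : symmetric e) (ei : irreflexive e) (XH : hausdorff_space X).
Context {pt : T -> X} {arc : T -> T -> R -> X}.
Context (pt_inj : injective pt).
Context (arcP : forall u v, e u v -> [/\ {within `[0, 1], continuous (arc u v)},
  arc u v 0 = pt u & arc u v 1 = pt v]).
Context (arc_sym : forall u v (t : R), e u v -> 0 <= t <= 1 -> arc v u t = arc u v (1 - t)).
Context (arc_pt : forall u v w (t : R), e u v -> 0 < t < 1 -> arc u v t <> pt w).
Context (arc_arc : forall u v x y (s t : R), e u v -> e x y -> 0 < s < 1 -> 0 < t < 1 ->
  arc u v s = arc x y t -> [/\ x = u, y = v & t = s] \/ [/\ x = v, y = u & t = 1 - s]).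

(** Constant when uv is not an edge, so that stars need no case distinction and
    contain their centre even when it is isolated. *)
Definition curve (u v : T) (t : R) : X := if e u v then arc u v t else pt u.
Definition star (u : T) : set X := \bigcup_(v in [set: T]) (curve u v @` [set` `[0, 1 / 3]]).
Definition middle (u v : T) : set X := curve u v @` [set` `[1 / 3, 2 / 3]].

Lemma curve_continuous u v (a b : R) : 0 <= a -> b <= 1 ->
  {within [set` `[a, b]], continuous (curve u v)}.
Proof.
move=> a0 b1; rewrite /curve; have [euv|_] := boolP (e u v); last first.
  by apply: continuous_subspaceT => x; exact: cvg_cst.
have [c _ _] := arcP euv; apply: continuous_subspaceW c => x /=.
by rewrite !in_itv /= => /andP[ax xb]; rewrite (le_trans a0 ax) (le_trans xb b1).
Qed.

Lemma curve0 u v : curve u v 0 = pt u.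
Proof. by rewrite /curve; have [/arcP[]|] := boolP (e u v). Qed.

Lemma curve_image_closed u v (a b : R) : 0 <= a -> b <= 1 ->
  closed (curve u v @` [set` `[a, b]]).
Proof.
move=> a0 b1; apply: (compact_closed XH).
by apply: continuous_compact (@segment_compact _ _ _); exact: curve_continuous.
Qed.

Lemma curve_image_connected u v (a b : R) : 0 <= a -> b <= 1 ->
  connected (curve u v @` [set` `[a, b]]).
Proof.
move=> a0 b1; apply: connected_continuous_connected (@segment_connected _ _ _) _.
exact: curve_continuous.
Qed.

Lemma star_closed u : closed (star u).
Proof.
apply: closed_bigcup => [|v _]; first exact: finite_finset.
by apply: curve_image_closed; lra.
Qed.

Lemma star_connected u : connected (star u).
Proof.
apply: bigcup_connected => [|v _]; last by apply: curve_image_connected; lra.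
exists (pt u) => v _; exists 0; last exact: curve0.
by rewrite /= in_itv /=; lra.
Qed.

Lemma star_pt u : star u (pt u).
Proof.
by exists u => //; exists 0; [rewrite /= in_itv /=; lra|exact: curve0].
Qed.

Lemma star_cases u x : star u x -> x = pt u \/
  exists v t, [/\ e u v, 0 < t <= 1 / 3 & x = arc u v t].
Proof.
move=> [v _ [t /=]]; rewrite in_itv /= => /andP[t0 t1] <-; rewrite /curve.
have [euv|_] := boolP (e u v); last by left.
move: t0; rewrite le_eqVlt => /orP[/eqP<-|t0].
  by left; have [] := arcP euv.
by right; exists v, t; split=> //; rewrite t0.
Qed.

Lemma middle_cases u v x : e u v -> middle u v x ->
  exists2 t : R, 1 / 3 <= t <= 2 / 3 & x = arc u v t.
Proof. by move=> euv [t /=]; rewrite in_itv /= /curve euv => tP <-; exists t. Qed.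

Lemma star_disjoint u v : star u `&` star v !=set0 -> u = v.
Proof.
move=> [x [/star_cases[xu|[u' [s [eu sP xu]]]] /star_cases[xv|[v' [t [ev tP xv]]]]]].
- by apply: pt_inj; rewrite -xu.
- by have /(_ u) := arc_pt (w := _) ev; case: (@arc_pt v v' u t ev); [lra|rewrite -xv].
- by case: (@arc_pt u u' v s eu); [lra|rewrite -xu].
- have st : arc u u' s = arc v v' t by rewrite -xu.
  by have [||[-> _ _]|[_ _ ts]] := arc_arc eu ev _ _ st; [lra|lra| |exfalso; lra].
Qed.

Lemma middle_star u v w : e u v -> middle u v `&` star w !=set0 -> w = u \/ w = v.
Proof.
move=> euv [x [/(middle_cases euv)[s sP xu] /star_cases[xw|[w' [t [ew tP xw]]]]]].
  by case: (@arc_pt u v w s euv); [lra|rewrite -xu].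
have st : arc u v s = arc w w' t by rewrite -xu.
by have [||[-> _ _]|[-> _ _]] := arc_arc euv ew _ _ st; [lra|lra|left|right].
Qed.

Lemma middle_middle u v x y : e u v -> e x y -> middle u v `&` middle x y !=set0 ->
  (x = u /\ y = v) \/ (x = v /\ y = u).
Proof.
move=> euv exy [z [/(middle_cases euv)[s sP zu] /(middle_cases exy)[t tP zx]]].
have st : arc u v s = arc x y t by rewrite -zu.
by have [||[-> -> _]|[-> -> _]] := arc_arc euv exy _ _ st; [lra|lra|left|right].
Qed.

Lemma middle_meets u v : e u v ->
  middle u v `&` star u !=set0 /\ middle u v `&` star v !=set0.
Proof.
move=> euv; split.
  exists (curve u v (1 / 3)); split; first by exists (1 / 3) => //; rewrite /= in_itv /=; lra.
  by exists v => //; exists (1 / 3) => //; rewrite /= in_itv /=; lra.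
exists (curve u v (2 / 3)); split; first by exists (2 / 3) => //; rewrite /= in_itv /=; lra.
exists u => //; exists (1 / 3); first by rewrite /= in_itv /=; lra.
rewrite /curve es euv arc_sym //; last by lra.
by congr (arc u v); lra.
Qed.

End Drawing.

(** The stars and the middle thirds of the arcs are connected compact sets that
    meet exactly as the vertices and edges of the graph are incident; their
    traces on a fine grid show the graph as a minor of the grid. *)
Lemma embedding_edge_bound {R : realType} {w : word} {X : topologicalType} {ell : nat}
    {letter : 'I_(size w) -> 'I_ell} {occ1 occ2 : 'I_ell -> 'I_(size w)}
    {T : finType} {e : rel T} :
  (0 < size w)%N ->
  (forall k : 'I_(size w), (nth (0, true)%N w k).1 = letter k) ->
  (forall k c, (letter k == c) = (k == occ1 c) || (k == occ2 c)) ->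
  (forall c, occ1 c != occ2 c) ->
  symmetric e -> irreflexive e ->
  polygon_quotient (R := R) w X -> embeds_in (R := R) e X ->
  (\sum_u #|[set v | e u v]%SET| <= 6 * (#|T| + ell))%N.
Proof.
move=> n0 letterE occP occN es ei [XH [q [qc qs qP]]] [pt [arc [pt_inj arcP arc_sym arc_pt arc_arc]]].
pose C (i : T + T * T) : set X := match i with
  | inl u => @star R X T e pt arc u | inr p => @middle R X T e pt arc p.1 p.2 end.
have arcP' u v : e u v -> [/\ {within `[0, 1], continuous (arc u v)},
    arc u v 0 = pt u & arc u v 1 = pt v].
  by move/arcP; have -> : [set` `[0, 1]%classic] = `[0, 1]%classic :> set R by exact: set_mem_set.
have Ccl i : closed (C i).
  case: i => [u|[u v]] /=; first exact: (star_closed XH arcP').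
  by apply: (curve_image_closed XH arcP'); lra.
have [m mP] := near_verts_disjoint n0 XH qc qP letterE occP Ccl.
have meet i j x : x \in @near_verts R w X q ell letter m m (C i) ->
    x \in @near_verts R w X q ell letter m m (C j) -> C i `&` C j !=set0.
  by move=> xi xj; apply/set0P/eqP => /mP/(_ xi xj).
have nconn i : connected (C i) -> _ := @near_verts_conn R w X q n0 XH qc qs qP ell letter occ1 occ2
  letterE occP m m (C i).
apply: (minor_edge_bound (polar_bdry_bdry occP occN (cc_glued n0 qP letterE))
  (polar_homology occP occN (cc_glued n0 qP letterE)) es ei
  (A := fun u => @near_verts R w X q ell letter m m (C (inl u)))
  (M := fun u v => @near_verts R w X q ell letter m m (C (inr (u, v))))) => //.
- move=> u; have su : C (inl u) `&` C (inl u) !=set0.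
    by rewrite setIid; exists (pt u); apply: star_pt arcP' _.
  have [x xu _] := near_verts_meet (letter := letter) (L' := m) (N1 := m) n0 qs su.
  by apply/set0Pn; exists x.
- by move=> u; apply: (nconn (inl u)); apply: star_connected.
- move=> u v x xu xv; apply: (star_disjoint pt_inj arcP' arc_pt arc_arc).
  exact: (meet (inl u) (inl v) x).
- by move=> u v euv; apply: (nconn (inr (u, v))); apply: curve_image_connected; [exact: arcP'|lra|lra].
- move=> u v euv; have [mu mv] := middle_meets (pt := pt) es arc_sym euv.
  split; first by have [x] := near_verts_meet (letter := letter) (L' := m) (N1 := m) n0 qs mu; exists x.
  by have [x] := near_verts_meet (letter := letter) (L' := m) (N1 := m) n0 qs mv; exists x.
- move=> u v x z euv xm zs; apply: (middle_star arcP' arc_pt arc_arc euv).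
  exact: (meet (inr (u, v)) (inl x) z).
- move=> u v x y z euv exy zm zm'; apply: (middle_middle arc_arc euv exy).
  exact: (meet (inr (u, v)) (inr (x, y)) z).
Qed.

(** * Surfaces *)

Section PairedWords.
Local Open Scope nat_scope.
Context {R : realType} {X : topologicalType} {T : finType} {e : rel T}.
Context (es : symmetric e) (ei : irreflexive e).

Lemma paired_word_edge_bound (w : word) (ell : nat) (o1 o2 : nat -> nat) :
  0 < size w -> (forall k, k < size w -> (nth (0, true) w k).1 < ell) ->
  (forall c, c < ell -> o1 c < o2 c < size w) ->
  (forall k c, k < size w -> c < ell ->
     ((nth (0, true) w k).1 == c) = (k == o1 c) || (k == o2 c)) ->
  polygon_quotient (R := R) w X -> embeds_in (R := R) e X ->
  \sum_u #|[set v | e u v]%SET| <= 6 * (#|T| + ell).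
Proof.
move=> n0 w_ell oP wP.
have o1n (c : 'I_ell) : o1 c < size w by have /andP[] := oP c (ltn_ord c); apply: ltn_trans.
have o2n (c : 'I_ell) : o2 c < size w by have /andP[] := oP c (ltn_ord c).
apply: (@embedding_edge_bound R w X ell (fun k => Ordinal (w_ell k (ltn_ord k)))
  (fun c => Ordinal (o1n c)) (fun c => Ordinal (o2n c))) => //.
  by move=> k c; rewrite -!val_eqE /= wP.
by move=> c; rewrite -val_eqE /= ltn_eqF //; have /andP[] := oP c (ltn_ord c).
Qed.

Lemma size_blocks {B : Type} (b : nat -> seq B) (m s g : nat) :
  (forall k, size (b k) = m) -> size (flatten [seq b k | k <- iota s g]) = g * m.
Proof.
by move=> bm; elim: g s => //= g IHg s; rewrite size_cat bm IHg mulSn.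
Qed.

Lemma nth_blocks {B : Type} (x0 : B) (b : nat -> seq B) (m s g i : nat) :
  (forall k, size (b k) = m) -> i < g * m ->
  nth x0 (flatten [seq b k | k <- iota s g]) i = nth x0 (b (s + i %/ m)) (i %% m).
Proof.
move=> bm; elim: g s i => //= g IHg s i ig; rewrite nth_cat bm.
have [im|mi] := ltnP i m; first by rewrite divn_small // modn_small // addn0.
rewrite IHg; last by rewrite ltn_subLR // -mulSn.
have m0 : 0 < m by case: m bm ig {IHg mi} => // _; rewrite muln0.
by rewrite -{3 4}(subnK mi) divnDr ?dvdnn // divnn m0 modnDr addn1 addnS.
Qed.

(** The words have k letters, except that the word of the sphere has one. *)
Lemma surface_edge_bound (k : nat) :
  surface_of_euler_genus (R := R) k X -> embeds_in (R := R) e X ->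
  \sum_u #|[set v | e u v]%SET| <= 6 * (#|T| + maxn k 1).
Proof.
case=> [[[|g] -> XP]|[k0 XP]].
- apply: (paired_word_edge_bound (o1 := fun=> 0) (o2 := fun=> 1) _ _ _ _ XP) => //=.
  + by case=> [|[|]].
  + by move=> [|[|i]] [|c] // _; lia.
- have sb b : size [:: (b.*2, true); (b.*2.+1, true); (b.*2, false); (b.*2.+1, false)] = 4 by [].
  have sw : size (orientable_word g.+1) = g.+1 * 4 by exact: size_blocks.
  have wE i : i < g.+1 * 4 -> (nth (0, true) (orientable_word g.+1) i).1 = i %/ 4 * 2 + i %% 2.
    move=> ig; rewrite (@nth_blocks _ _ _ 4) // add0n -muln2.
    have im : i %% 4 < 4 by rewrite ltn_mod.
    have : i %% 2 = (i %% 4) %% 2 by lia.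
    by case: (i %% 4) im => [|[|[|[|]]]] //= _; lia.
  rewrite (_ : maxn g.+1.*2 1 = g.+1.*2); last by lia.
  apply: (paired_word_edge_bound (o1 := fun c => c %/ 2 * 4 + c %% 2)
    (o2 := fun c => c %/ 2 * 4 + c %% 2 + 2) _ _ _ _ XP); rewrite ?sw //.
  + by move=> i ig; rewrite wE //; lia.
  + by move=> c cg; lia.
  + by move=> i c ig cg; rewrite wE //; lia.
- have sw : size (nonorientable_word k) = k * 2 by exact: size_blocks.
  have wE i : i < k * 2 -> (nth (0, true) (nonorientable_word k) i).1 = i %/ 2.
    move=> ig; rewrite (@nth_blocks _ _ _ 2) // add0n.
    have im : i %% 2 < 2 by rewrite ltn_mod.
    by case: (i %% 2) im => [|[|]].
  rewrite (_ : maxn k 1 = k); last by lia.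
  apply: (paired_word_edge_bound (o1 := fun c => c * 2)
    (o2 := fun c => c * 2 + 1) _ _ _ _ XP); rewrite ?sw //.
  + by lia.
  + by move=> i ig; rewrite wE //; lia.
  + by move=> c cg; lia.
  + by move=> i c ig cg; rewrite wE //; lia.
Qed.

End PairedWords.

Lemma embeds_in_sub {R : realType} {X : topologicalType} {T : finType} {e : rel T} (S : {set T}) :
  embeds_in (R := R) e X ->
  embeds_in (R := R) (fun x y : {x | x \in S} => e (val x) (val y)) X.
Proof.
move=> [pt [arc [pt_inj arcP arc_sym arc_pt arc_arc]]].
exists (fun x => pt (val x)), (fun x y => arc (val x) (val y)); split.
- by move=> x y /pt_inj/val_inj.
- by move=> u v; apply: arcP.
- by move=> u v t; apply: arc_sym.
- by move=> u v x t euv t01; apply: arc_pt.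
- move=> u v x y s t euv exy s01 t01 st.
  by have [[/val_inj-> /val_inj-> ->]|[/val_inj-> /val_inj-> ->]] := arc_arc _ _ _ _ _ _ euv exy s01 t01 st;
    [left|right].
Qed.

(** If all degrees in S exceed d, then S has more than d + 1 vertices and
    (d + 1) #|S| <= 6 (#|S| + ell), which contradicts the choice of d. *)
Lemma surface_low_degree {R : realType} {X : topologicalType} {T : finType} {e : rel T}
    (k d : nat) (S : {set T}) :
  symmetric e -> irreflexive e -> surface_of_euler_genus (R := R) k X -> embeds_in (R := R) e X ->
  (6 <= d)%N -> (6 * maxn k 1 < (d + 2) * (d - 5))%N -> S != finset.set0 ->
  exists2 v, v \in S & (#|[set w in S | e v w]%SET| <= d)%N.
Proof.
move=> es ei Xk eX d6 dk /set0Pn[x0 x0S].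
have [/exists_inP[v vS vd]|/exists_inPn no] :=
  boolP [exists v in S, (#|[set w in S | e v w]%SET| <= d)%N]; first by exists v.
exfalso; pose e' (x y : {x | x \in S}) := e (val x) (val y).
have degE (x : {x | x \in S}) : #|[set y | e' x y]%SET| = #|[set w in S | e (val x) w]%SET|.
  rewrite -(card_imset _ val_inj); apply: eq_card => y; rewrite !inE.
  apply/imsetP/andP => [[z + ->]|[yS xy]]; first by rewrite inE => xz; split=> //; exact: valP.
  by exists (exist _ y yS); rewrite ?inE.
have deg (x : {x | x \in S}) : (d < #|[set y | e' x y]%SET|)%N.
  by rewrite degE ltnNge; apply: no; exact: valP.
have := surface_edge_bound (e := e') (fun x y => es _ _) (fun x => ei _) Xk (embeds_in_sub S eX).
have : (\sum_(x : {x | x \in S}) d.+1 <= \sum_x #|[set y | e' x y]%SET|)%N.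
  by apply: leq_sum => x _; apply: deg.
have : (d.+1 < #|{: {x | x \in S}}|)%N.
  have := deg (exist _ x0 x0S); set x := exist _ x0 x0S => dx.
  have : (#|[set y | e' x y]%SET| <= #|predC1 x|)%N.
    apply/subset_leq_card/fintype.subsetP => y; rewrite !inE.
    by apply: contraTneq => ->; rewrite /e' ei.
  by move=> /(leq_trans dx); rewrite cardC1 -subn1 ltn_subRL.
rewrite sum_nat_const; set N := #|_| => N1 N2 N3; have N4 := leq_trans N2 N3.
have {N2 N3} [m mE] : exists m, d = (m + 6)%N by exists (d - 6)%N; lia.
rewrite mE in dk N1 N4; have [p pE] : exists p, N = (p + m + 8)%N by exists (N - m - 8)%N; lia.
rewrite pE in N4; nia.
Qed.

(** * The bounds *)

Lemma proper_orientation_number_genus {R : realType} {T : finType} {e : rel T} (gamma d : nat) :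
  symmetric e -> irreflexive e -> has_euler_genus R e gamma ->
  (6 <= d)%N -> (6 * maxn gamma 1 < (d + 2) * (d - 5))%N ->
  (proper_orientation_number e <= 7 * d + 1)%N.
Proof.
move=> es ei [[X Xg eX] _] d6 dg; apply: proper_orientation_number_degenerate => //.
  exact: leq_trans d6.
by move=> S; apply: surface_low_degree es ei Xg eX d6 dg.
Qed.

(** With s = sqrt (gamma + 1) and a = floor (3 s), take d = a + 6: then
    (d + 2) (d - 5) >= (a + 1) ^ 2 > 9 (gamma + 1), and
    7 d + 1 <= 21 s + 43 <= 64 s. *)
Lemma proper_orientation_number_sqrt_bound {R : realType} {T : finType} {e : rel T} (gamma : nat) :
  symmetric e -> irreflexive e -> has_euler_genus R e gamma ->
  (proper_orientation_number e)%:R <= 64 * Num.sqrt (gamma%:R + 1) :> R.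
Proof.
move=> es ei eg; set s := Num.sqrt _.
have s2 : s ^+ 2 = gamma%:R + 1 by rewrite sqr_sqrtr // addr_ge0.
have s1 : 1 <= s.
  by rewrite -[1]sqrtr1 ler_sqrt ?lerDr ?ler0n // addr_ge0.
pose a := Num.truncn (3 * s).
have /andP[a1 a2] : a%:R <= 3 * s < a.+1%:R.
  by apply: truncn_itv; lra.
have ag : (9 * (gamma + 1) < a.+1 * a.+1)%N.
  by rewrite -(ltr_nat R) !natrM natrD -s2; nra.
have := proper_orientation_number_genus (d := a + 6) es ei eg (leq_addl _ _).
move=> /(_ ltac:(nia)); rewrite -(ler_nat R) => /le_trans; apply.
by rewrite natrD natrM natrD; lra.
Qed.

(** Here 7 d + 1 must stay below 9 D + 6 while (d + 2) (d - 5) exceeds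
    6 gamma <= 3 / 2 * (D - 2) ^ 2 - 9; the value d = floor (5 D / 4) does both
    as soon as D >= 9.  The two remaining terms of the bound are
    nonnegative. *)
Lemma proper_orientation_number_D_bound {R : realType} {T : finType} {e : rel T} (gamma : nat) :
  symmetric e -> irreflexive e -> (1 <= gamma)%N -> has_euler_genus R e gamma ->
  (proper_orientation_number e)%:Z
    <= Num.ceil (3 + 1 / 2 * Num.sqrt (6 * gamma%:R) : R) + F (D_ R gamma).
Proof.
move=> es ei g1 eg; set D := D_ R gamma; set s : R := Num.sqrt (4 * gamma%:R + 6).
have s2 : s ^+ 2 = 4 * gamma%:R + 6 by rewrite sqr_sqrtr // addr_ge0 // mulr_ge0.
have s0 : 0 <= s by exact: sqrtr_ge0.
have : Num.max 9 (2 + s) <= D%:~R by exact: ceil_ge.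
rewrite ge_max => /andP[D9 Ds].
have D9' : 9 <= D by rewrite -(ler_int R).
have [n nE] : exists n : nat, D = n%:Z by exists `|D|%N; lia.
have n9 : (9 <= n)%N by lia.
rewrite nE -pmulrn in Ds.
have n2 : (4 * gamma + 6 <= (n - 2) * (n - 2))%N.
  by rewrite -(ler_nat R) !natrM natrD natrM -s2 natrB; [nra|lia].
pose d := ((5 * n) %/ 4)%N.
have d1 : (5 * n <= 4 * d + 3)%N by lia.
have d2 : (4 * d <= 5 * n)%N by lia.
have bound : (proper_orientation_number e <= 7 * d + 1)%N.
  apply: proper_orientation_number_genus eg _ _ => //; first by lia.
  rewrite (_ : maxn gamma 1 = gamma); last by lia.
  have [p pE] : exists p, d = (p + 11)%N by exists (d - 11)%N; lia.
  have [k kE] : exists k, n = (k + 9)%N by exists (n - 9)%N; lia.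
  subst n; rewrite pE in d1 *.
  have -> : (p + 11 + 2)%N = (p + 13)%N by lia.
  have -> : (p + 11 - 5)%N = (p + 6)%N by lia.
  have n2' : (4 * gamma + 6 <= (k + 7) * (k + 7))%N.
    by move: n2; have -> : (k + 9 - 2)%N = (k + 7)%N by lia.
  clear -d1 n2'; nia.
have c0 : 0 <= Num.ceil (3 + 1 / 2 * Num.sqrt (6 * gamma%:R) : R).
  by rewrite -(ler_int R); apply: le_trans (ceil_ge _); rewrite addr_ge0 // mulr_ge0 // sqrtr_ge0.
have f0 : 0 <= Num.floor (3 / 2 * (Num.ceil ((2 * D + 2)%:~R / 5 : rat))%:~R : rat).
  rewrite floor_ge0 mulr_ge0 // ler0z -(ler_int rat); apply: le_trans (ceil_ge _).
  by rewrite divr_ge0 // ler0z; lia.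
by rewrite /F; lia.
Qed.

Unset Implicit Arguments.

Theorem theorem1p4 (R : realType) :
  (exists C : R,
     forall (T : finType) (e : rel T) (gamma : nat),
       symmetric e -> irreflexive e -> has_euler_genus R e gamma ->
       (proper_orientation_number e)%:R <= C * Num.sqrt (gamma%:R + 1))
  /\
  (forall (T : finType) (e : rel T) (gamma : nat),
     symmetric e -> irreflexive e -> (1 <= gamma)%N ->
     has_euler_genus R e gamma ->
     (proper_orientation_number e)%:Z
       <= Num.ceil (3 + 1 / 2 * Num.sqrt (6 * gamma%:R) : R) + F (D_ R gamma)).
Proof.
split; first by exists 64 => T e gamma; exact: proper_orientation_number_sqrt_bound.
by move=> T e gamma; exact: proper_orientation_number_D_bound.
Qed.
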